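(* Let $\lambda_1,\lambda_2,\lambda_3,\lambda_4\in\mathbb{C}$ be such that $\sum_{i\in I}\lambda_i\notin\frac12\mathbb{Z}_{\ge0}$ for every nonempty $I\subseteq\{1,2,3,4\}$. Let $\lambda_{12},\lambda_{34},\lambda_{123},\lambda_{234},\lambda_{1234}$ be such that $\lambda_1+\lambda_2-\lambda_{12}$, $\lambda_3+\lambda_4-\lambda_{34}$, $\lambda_{12}+\lambda_3-\lambda_{123}$, $\lambda_2+\lambda_{34}-\lambda_{234}$, $\lambda_{123}+\lambda_4-\lambda_{1234}$, $\lambda_1+\lambda_{234}-\lambda_{1234}$, $\lambda_{12}+\lambda_{34}-\lambda_{1234}$ all lie in $\mathbb{Z}_{\ge0}$. Then $$\sum_\alpha\begin{Bmatrix}\lambda_1&\lambda_2&\lambda_{12}\\ \lambda_3&\lambda_{123}&\alpha\end{Bmatrix}_q\begin{Bmatrix}\lambda_1&\alpha&\lambda_{123}\\ \lambda_4&\lambda_{1234}&\lambda_{234}\end{Bmatrix}_q\begin{Bmatrix}\lambda_2&\lambda_3&\alpha\\ \lambda_4&\lambda_{234}&\lambda_{34}\end{Bmatrix}_q=\begin{Bmatrix}\lambda_{12}&\lambda_3&\lambda_{123}\\ \lambda_4&\lambda_{1234}&\lambda_{34}\end{Bmatrix}_q\begin{Bmatrix}\lambda_1&\lambda_2&\lambda_{12}\\ \lambda_{34}&\lambda_{1234}&\lambda_{234}\end{Bmatrix}_q,$$ where the sum is over $\alpha=\lambda_2+\lambda_3-j$, $j=0,1,\ldots,\min\{\lambda_2+\lambda_3+\lambda_4-\lambda_{234},\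 \lambda_1+\lambda_2+\lambda_3-\lambda_{123}\}$.
   Context: Notation: $q=e^{h/2}$ with $h\in\mathbb{C}$, $q^x:=e^{hx/2}$, $[x]_q=\frac{q^x-q^{-x}}{q-q^{-1}}$, $[n]_q!=\prod_{s=1}^n[s]_q$, $[0]_q!=1$, $(-1)^{J/2}:=e^{i\pi J/2}$. The parameter $q$ is generic: $[x]_q\neq0$ for every nonzero $x\in\mathbb{Z}+\sum_{i=1}^42\mathbb{Z}\lambda_i$. Terms with $[n]_q!$, $n$ a negative integer, in the denominator are omitted; empty products equal $1$. For $\mu\notin\frac12\mathbb{Z}_{\ge0}$ the Verma module $M_\mu$ of $U_q(\mathfrak{sl}_2)$ has basis $e^\mu_a$, $a\in\mu-\mathbb{Z}_{\ge0}$, with $Ke^\mu_a=q^{2a}e^\mu_a$, $Ee^\mu_a=[\mu-a]_qe^\mu_{a+1}$, $Fe^\mu_a=[\mu+a]_qe^\mu_{a-1}$; the coproduct is $\Delta E=E\otimes K+1\otimes E$, $\Delta F=F\otimes1+K^{-1}\otimes F$, $\Delta K=K\otimes K$. For $\mu=\mu_1+\mu_2-J$, $J\in\mathbb{Z}_{\ge0}$, the $q3j$-symbols $$\begin{bmatrix}\mu_1&\mu_2&\mu\\ a_1&a_2&a\end{bmatrix}^\psi_q=(-1)^{\frac J2+\mu_1-a_1}q^{(\mu_2^2-a_2^2)-(\mu^2-a^2)-(\mu_1-a_1)}\frac{[\mu-a]_q!\,\Delta(\mu_1,\mu_2,\mu)}{\prod_{j=1}^{\mu-a}[\mu+a+j]_q}\sum_{z+w=\mu-a}(-1)^zq^{z(\mu+a+1)}\frac{\prod_{j=1}^z[\mu_1+a_1+j]_q\prod_{j=1}^w[\mu_2+a_2+j]_q}{[z]_q![w]_q![\mu_1-a_1-z]_q![\mu_2-a_2-w]_q!}$$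 ($z,w\in\mathbb{Z}_{\ge0}$, $a=a_1+a_2$; zero otherwise) are the matrix coefficients of a module embedding $M_\mu\hookrightarrow M_{\mu_1}\otimes M_{\mu_2}$. Here $\Delta(\mu_1,\mu_2,\mu)=\Big([J]_q!\prod_{j=0}^{J-1}\frac{[2\mu_1-j]_q[2\mu_2-j]_q}{[2\mu+2+j]_q}\Big)^{1/2}$ with square roots fixed once and for all so that $\Delta(\mu_1,\mu_2,\mu)=\Delta(\mu_2,\mu_1,\mu)$. $q6j$-symbols: for an ordered triple $(\mu_1,\mu_2,\mu_3)$ of weights define in $M_{\mu_1}\otimes M_{\mu_2}\otimes M_{\mu_3}$ $$e^{\mu_{12},\mu}_a=\sum_{a_1+a_2+a_3=a}\begin{bmatrix}\mu_{12}&\mu_3&\mu\\ a_1+a_2&a_3&a\end{bmatrix}^\psi_q\begin{bmatrix}\mu_1&\mu_2&\mu_{12}\\ a_1&a_2&a_1+a_2\end{bmatrix}^\psi_qe^{\mu_1}_{a_1}\otimes e^{\mu_2}_{a_2}\otimes e^{\mu_3}_{a_3},$$ $$e^{\mu_{23},\mu}_a=\sum_{a_1+a_2+a_3=a}\begin{bmatrix}\mu_1&\mu_{23}&\mu\\ a_1&a_2+a_3&a\end{bmatrix}^\psi_q\begin{bmatrix}\mu_2&\mu_3&\mu_{23}\\ a_2&a_3&a_2+a_3\end{bmatrix}^\psi_qe^{\mu_1}_{a_1}\otimes e^{\mu_2}_{a_2}\otimes e^{\mu_3}_{a_3}$$ ($3j$-symbols being $0$ when a weight does not occur in the corresponding module).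 For $\mu_1+\mu_2-\mu_{12},\mu_{12}+\mu_3-\mu\in\mathbb{Z}_{\ge0}$, the $q6j$-symbols are the coefficients (independent of $a$) in $$e^{\mu_{12},\mu}_a=\sum_{\mu_{23}}\begin{Bmatrix}\mu_1&\mu_2&\mu_{12}\\ \mu_3&\mu&\mu_{23}\end{Bmatrix}_qe^{\mu_{23},\mu}_a,$$ the sum being over $\mu_{23}$ with $\mu_2+\mu_3-\mu_{23},\ \mu_1+\mu_{23}-\mu\in\mathbb{Z}_{\ge0}$. *)

(* Defs.v *)
From HB Require Import structures.
From mathcomp Require Import all_boot all_order all_algebra.
From mathcomp Require Import all_classical all_reals all_analysis.
From mathcomp Require Import complex.

Set Implicit Arguments.
Unset Strict Implicit.
Unset Printing Implicit Defensive.

Import Order.TTheory GRing.Theory Num.Theory.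

Local Open Scope classical_set_scope.
Local Open Scope ring_scope.
Local Open Scope complex_scope.

(* Weights are complex numbers.  [toN x] is the natural number n such that
   x = n%:R when there is one ([isN x]); it is only meaningful in that case. *)
Definition toN (R : realType) (x : R[i]) : nat := Num.truncn (complex.Re x).

Definition isN (R : realType) (x : R[i]) : bool := x == (toN x)%:R.

(* x belongs to (1/2) Z_{>= 0} *)
Definition is_halfN (R : realType) (x : R[i]) : bool := isN (2 * x).

Definition cexp (R : realType) (z : R[i]) : R[i] :=
  (expR (complex.Re z))%:C * (cos (complex.Im z) +i* sin (complex.Im z)).

(* (-1)^x := e^(i pi x) *)
Definition signpow (R : realType) (x : R[i]) : R[i] :=
  cexp ((0 +i* pi) * x).

(* q^x := e^(h x / 2); in particular q = qpow h 1 *)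
Definition qpow (R : realType) (h x : R[i]) : R[i] := cexp (h * x / 2).

Definition qnum (R : realType) (h x : R[i]) : R[i] :=
  (qpow h x - qpow h (- x)) / (qpow h 1 - qpow h (- 1)).

Definition qfact (R : realType) (h : R[i]) (n : nat) : R[i] :=
  \prod_(1 <= s < n.+1) qnum h s%:R.

(* \prod_(j = 1)^n [x + j]_q *)
Definition qrising (R : realType) (h x : R[i]) (n : nat) : R[i] :=
  \prod_(1 <= j < n.+1) qnum h (x + j%:R).

(* The radicand in Delta (m1, m2, m), where m = m1 + m2 - J. *)
Definition Delta_radicand (R : realType) (h m1 m2 m : R[i]) : R[i] :=
  let J := toN (m1 + m2 - m) in
  qfact h J *
  \prod_(0 <= j < J)
    (qnum h (2 * m1 - j%:R) * qnum h (2 * m2 - j%:R) /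
     qnum h (2 * m + 2 + j%:R)).

(* D is a choice of the square roots Delta (m1, m2, m), symmetric in m1, m2. *)
Definition Delta_choice (R : realType) (h : R[i])
    (D : R[i] -> R[i] -> R[i] -> R[i]) : Prop :=
  forall m1 m2 m : R[i], isN (m1 + m2 - m) ->
    D m1 m2 m ^+ 2 = Delta_radicand h m1 m2 m /\ D m1 m2 m = D m2 m1 m.

(* The side condition z <= m1 - a1, w <= m2 - a2 on the sum implements the
   omission of the terms with factorials of negative integers in the
   denominator. *)
Definition q3j (R : realType) (h : R[i]) (D : R[i] -> R[i] -> R[i] -> R[i])
    (m1 m2 m a1 a2 a : R[i]) : R[i] :=
  let n1 := toN (m1 - a1) in
  let n2 := toN (m2 - a2) in
  let n := toN (m - a) in
  if [&& isN (m1 + m2 - m), isN (m1 - a1), isN (m2 - a2), isN (m - a)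
       & a == a1 + a2] then
    signpow ((m1 + m2 - m) / 2 + (m1 - a1)) *
    qpow h ((m2 ^+ 2 - a2 ^+ 2) - (m ^+ 2 - a ^+ 2) - (m1 - a1)) *
    (qfact h n * D m1 m2 m / qrising h (m + a) n) *
    \sum_(z < n.+1 | (z <= n1)%N && (n - z <= n2)%N)
      (let w := (n - z)%N in
       (-1) ^+ z * qpow h (z%:R * (m + a + 1)) *
       (qrising h (m1 + a1) z * qrising h (m2 + a2) w) /
       (qfact h z * qfact h w * qfact h (n1 - z) * qfact h (n2 - w)))
  else 0.

(* A vector of M_{m1} (x) M_{m2} (x) M_{m3} is given by its coordinates: its
   value at (a1, a2, a3) is the coefficient of the basis vector
   e^{m1}_{a1} (x) e^{m2}_{a2} (x) e^{m3}_{a3}.  In the two definitions below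
   the coordinates vanish unless m_i - a_i is in Z_{>= 0} for all i and
   a1 + a2 + a3 = a, because the 3j-symbols do. *)
Definition e12 (R : realType) (h : R[i]) (D : R[i] -> R[i] -> R[i] -> R[i])
    (m1 m2 m3 m12 m a : R[i]) : R[i] -> R[i] -> R[i] -> R[i] :=
  fun a1 a2 a3 =>
    q3j h D m12 m3 m (a1 + a2) a3 a * q3j h D m1 m2 m12 a1 a2 (a1 + a2).

Definition e23 (R : realType) (h : R[i]) (D : R[i] -> R[i] -> R[i] -> R[i])
    (m1 m2 m3 m23 m a : R[i]) : R[i] -> R[i] -> R[i] -> R[i] :=
  fun a1 a2 a3 =>
    q3j h D m1 m23 m a1 (a2 + a3) a * q3j h D m2 m3 m23 a2 a3 (a2 + a3).

(* The families c of coefficients, indexed by the weight m23 and independent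
   of a, expressing e^{m12,m}_a through the e^{m23,m}_a.  The weights m23 with
   m2 + m3 - m23 and m1 + m23 - m in Z_{>= 0} are the m2 + m3 - j,
   0 <= j <= m1 + m2 + m3 - m. *)
Definition q6j_families (R : realType) (h : R[i])
    (D : R[i] -> R[i] -> R[i] -> R[i]) (m1 m2 m12 m3 m : R[i]) :
    set (R[i] -> R[i]) :=
  [set c | forall a : R[i], isN (m - a) ->
    forall a1 a2 a3 : R[i],
      e12 h D m1 m2 m3 m12 m a a1 a2 a3 =
      \sum_(j < (toN (m1 + m2 + m3 - m)).+1)
        c (m2 + m3 - j%:R) * e23 h D m1 m2 m3 (m2 + m3 - j%:R) m a a1 a2 a3].

(* q6j h D m1 m2 m12 m3 m m23 is the symbol with rows (m1, m2, m12) and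
   (m3, m, m23): the value at m23 of such a family of coefficients. *)
Definition q6j (R : realType) (h : R[i]) (D : R[i] -> R[i] -> R[i] -> R[i])
    (m1 m2 m12 m3 m m23 : R[i]) : R[i] :=
  xget 0 [set c m23 | c in q6j_families h D m1 m2 m12 m3 m].

(* l1, ..., l4 are the entries of l; [x]_q <> 0 for all nonzero x in
   Z + \sum_i 2 Z l_i.  For x = 1 this includes q <> q^-1, as u / 0 = 0. *)
Definition q_generic (R : realType) (h : R[i]) (l : seq R[i]) : Prop :=
  forall (k : int) (c : 'I_4 -> int),
    let x := k%:~R + \sum_(i < 4) 2 * (c i)%:~R * l`_i in
    x != 0 -> qnum h x != 0.

(* Main.v *)
Require Import Defs.
From HB Require Import structures.
From mathcomp Require Import all_boot all_order all_algebra.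
From mathcomp Require Import all_classical all_reals all_analysis.
From mathcomp Require Import complex.
From mathcomp Require Import ring zify.

(* The numerator of a q3j-symbol is a singular vector of M_{m1} (x) M_{m2} to
   which a power of F has been applied and expanded by the q-binomial theorem;
   hence the q3j-symbols intertwine E and F.  Applying E repeatedly shows that,
   in each weight space of M_{m1} (x) M_{m2}, they form a basis.  In a triple
   tensor product a singular vector is determined by its component on the
   highest weight vector of the first factor; expanding that component in the
   basis of M_{m2} (x) M_{m3} gives existence and uniqueness of the
   q6j-symbols.  The pentagon identity then compares the two expansions of one
   vector of the fourfold product in the linearly independent family attached
   to the bracketing 1(2(34)). *)

Set Implicit Arguments.
Unset Strict Implicit.
Unset Printing Implicit Defensive.

Import Order.TTheory GRing.Theory Num.Theory.

Local Open Scope ring_scope.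
Local Open Scope complex_scope.

(** * Quantum numbers and the action of E and F on a tensor product *)

Section QuantumNumbers.
Variables (K : fieldType) (Q : K -> K).
Hypothesis QD : forall x y, Q (x + y) = Q x * Q y.
Hypothesis Q0 : Q 0 = 1.

Definition br (x : K) : K := (Q x - Q (- x)) / (Q 1 - Q (- 1)).

Hypothesis br_nat : forall n, br n.+1%:R != 0.

Lemma Q_neq0 x : Q x != 0.
Proof.
apply/eqP => Qx0; have /eqP := Q0.
by rewrite -(subrr x) QD Qx0 mul0r eq_sym oner_eq0.
Qed.

Lemma QN x : Q (- x) = (Q x)^-1.
Proof.
by apply: (mulfI (Q_neq0 x)); rewrite -QD subrr Q0 mulfV ?Q_neq0.
Qed.

Lemma Qden_neq0 : Q 1 - (Q 1)^-1 != 0.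
Proof.
by have := br_nat 0; rewrite /br mulf_eq0 invr_eq0 negb_or QN => /andP[].
Qed.

Lemma Qsqr_neq1 : Q 1 * Q 1 - 1 != 0.
Proof.
have -> : Q 1 * Q 1 - 1 = Q 1 * (Q 1 - (Q 1)^-1).
  by rewrite mulrBr mulfV ?Q_neq0.
by rewrite mulf_neq0 ?Q_neq0 ?Qden_neq0.
Qed.

Lemma br0 : br 0 = 0.
Proof. by rewrite /br oppr0 subrr mul0r. Qed.

Lemma br1 : br 1 = 1.
Proof. by rewrite /br QN divff // Qden_neq0. Qed.

(** The q-analogue of additivity; it gives the q-Pascal rule and splits the Cartan term of
    [EF_commutator] between the two factors. *)
Lemma brD x y : br (x + y) = Q y * br x + Q (- x) * br y.
Proof.
rewrite /br opprD !QD !QN.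
have := Q_neq0 x; have := Q_neq0 y; have := Q_neq0 1; have := Qsqr_neq1.
move: (Q x) (Q y) (Q 1) => u v w ? ? ? ?.
by field; apply/and4P; split.
Qed.

Lemma brB x y : br (x + 1) * br y - br x * br (y + 1) = br (y - x).
Proof.
rewrite /br !opprD !QD !QN ?opprK ?invrK.
have := Q_neq0 x; have := Q_neq0 y; have := Q_neq0 1; have := Qsqr_neq1.
move: (Q x) (Q y) (Q 1) => u v w ? ? ? ?.
by field; apply/and4P; split.
Qed.

(* The coefficient of F : v_{k-1} -> v_k in the Verma module of highest weight
   m, with v_k = e^m_{m-k}; the value 0 at k = 0 stands for v_{-1} = 0. *)
Definition fc (m : K) (k : nat) : K := if k is k'.+1 then br (2 * m - k'%:R) else 0.

(** Coordinates of F (x) 1 + K^-1 (x) F. At index 0 the value of [.-1] is harmless, as [fc] vanishes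
    there. *)
Definition Fop (m1 m2 : K) (x : nat -> nat -> K) (n1 n2 : nat) : K :=
  fc m1 n1 * x n1.-1 n2 + Q (- (2 * (m1 - n1%:R))) * fc m2 n2 * x n1 n2.-1.

Definition Eop (m2 : K) (x : nat -> nat -> K) (n1 n2 : nat) : K :=
  br n1.+1%:R * Q (2 * (m2 - n2%:R)) * x n1.+1 n2 + br n2.+1%:R * x n1 n2.+1.

(** The relation EF - FE = (K - K^-1)/(q - q^-1), which acts as [2a] on weight a: [hfc] is its form
    in one Verma module, and the mixed terms cancel. *)
Lemma EF_commutator m1 m2 x n1 n2 :
  Eop m2 (Fop m1 m2 x) n1 n2 =
  Fop m1 m2 (Eop m2 x) n1 n2 + br (2 * (m1 + m2 - (n1 + n2)%:R)) * x n1 n2.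
Proof.
have -> : br (2 * (m1 + m2 - (n1 + n2)%:R)) =
  Q (2 * (m2 - n2%:R)) * br (2 * (m1 - n1%:R)) +
  Q (- (2 * (m1 - n1%:R))) * br (2 * (m2 - n2%:R)).
  by rewrite -brD natrD; congr br; ring.
have hfc (m : K) n : br n.+1%:R * fc m n.+1 - br n%:R * fc m n = br (2 * (m - n%:R)).
  case: n => [|n] /=; first by rewrite br0 br1 mul0r mul1r !subr0.
  have -> : 2 * m - n%:R = 2 * m - n.+1%:R + 1 by rewrite -natr1; ring.
  by rewrite -[n.+2%:R]natr1 brB; congr br; ring.
rewrite -!hfc /Eop /Fop /=.
have hl (m : K) n : Q (- (2 * (m - n.+1%:R))) = Q (- (2 * (m - n%:R))) * Q 2.
  by rewrite -QD -natr1; congr Q; ring.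
have hr (m : K) n : Q (2 * (m - n%:R)) = Q (2 * (m - n.+1%:R)) * Q 2.
  by rewrite -QD -natr1; congr Q; ring.
rewrite (hl m1 n1); case: n1 n2 => [|n1] [|n2] /=; rewrite ?br0 ?br1 ?(hr m2 n2).
all: by ring.
Qed.

Lemma eq_Fop m1 m2 x y : (forall n1 n2, x n1 n2 = y n1 n2) ->
  forall n1 n2, Fop m1 m2 x n1 n2 = Fop m1 m2 y n1 n2.
Proof. by move=> xy n1 n2; rewrite /Fop !xy. Qed.

Lemma Fop_lin m1 m2 a x n1 n2 :
  Fop m1 m2 (fun k l => a * x k l) n1 n2 = a * Fop m1 m2 x n1 n2.
Proof. by rewrite /Fop; ring. Qed.

(** * Powers of F on a singular vector *)

Section SingularVector.
Variables (m1 m2 : K) (J : nat) (x : nat -> nat -> K).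
Hypothesis x_supp : forall n1 n2, (n1 + n2)%N != J -> x n1 n2 = 0.
Hypothesis Ex0 : forall n1 n2, Eop m2 x n1 n2 = 0.

Lemma iter_Fop_supp n n1 n2 :
  (n1 + n2)%N != (J + n)%N -> iter n (Fop m1 m2) x n1 n2 = 0.
Proof.
elim: n n1 n2 => [|n IH] n1 n2; first by rewrite addn0; apply: x_supp.
move=> hn; rewrite iterS /Fop.
have -> : fc m1 n1 * iter n (Fop m1 m2) x n1.-1 n2 = 0.
  case: n1 hn => [|n1] hn /=; first by rewrite mul0r.
  by rewrite IH ?mulr0 //; apply: contraNN hn => /eqP; lia.
rewrite add0r; case: n2 hn => [|n2] hn /=; first by rewrite mulr0 mul0r.
by rewrite IH ?mulr0 //; apply: contraNN hn => /eqP; lia.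
Qed.

Let m := m1 + m2 - J%:R.

(** The usual sl_2 computation: moving E past one more F adds [2a] at the current weight a, and
    [brB] absorbs it into the product. *)
Lemma Eop_iter_Fop n n1 n2 :
  Eop m2 (iter n.+1 (Fop m1 m2) x) n1 n2 =
  br n.+1%:R * br (2 * m - n%:R) * iter n (Fop m1 m2) x n1 n2.
Proof.
elim: n n1 n2 => [|n IH] n1 n2.
  rewrite iterS EF_commutator [X in X + _](_ : _ = 0); last first.
    by rewrite /Fop !Ex0 !mulr0 addr0.
  rewrite add0r br1 mul1r /= subr0.
  case: (eqVneq (n1 + n2)%N J) => [->//|/x_supp->]; first by rewrite !mulr0.
rewrite iterS EF_commutator (eq_Fop _ _ IH) Fop_lin -iterS.
case: (eqVneq (n1 + n2)%N (J + n.+1)%N) => [->|/iter_Fop_supp->]; last first.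
  by rewrite !mulr0 addr0.
rewrite -mulrDl; congr (_ * _).
have -> : 2 * m - n%:R = 2 * m - n.+1%:R + 1 by rewrite -natr1; ring.
rewrite -[n.+2%:R]natr1 -[X in _ + X = _](_ : br (2 * m - n.+1%:R - n.+1%:R) = _).
  by rewrite -brB; ring.
by congr br; rewrite /m natrD; ring.
Qed.

End SingularVector.

(** * q-factorials and powers of F on a tensor product *)

Definition qf (n : nat) : K := \prod_(1 <= s < n.+1) br s%:R.

Lemma qfS n : qf n.+1 = qf n * br n.+1%:R.
Proof. by rewrite /qf big_nat_recr. Qed.

Lemma qf_neq0 n : qf n != 0.
Proof.
elim: n => [|n IH]; first by rewrite /qf big_nil oner_neq0.
by rewrite qfS mulf_neq0.
Qed.

(* The coefficient of F ^ z : v_{k-z} -> v_k; it vanishes for z > k. *)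
Definition fcprod (m : K) (k z : nat) : K := \prod_(i < z) fc m (k - i).

Lemma fcprodS m k z : fcprod m k z.+1 = fc m k * fcprod m k.-1 z.
Proof.
rewrite /fcprod big_ord_recl subn0; congr (_ * _); apply: eq_bigr => i _.
by rewrite -predn_sub subnS -!subn1 subnAC.
Qed.

Lemma fcprod_gt m k z : (k < z)%N -> fcprod m k z = 0.
Proof.
by move=> kz; rewrite /fcprod (bigD1 (Ordinal kz)) //= subnn mul0r.
Qed.

(* The q-binomial theorem for (F (x) 1 + K^-1 (x) F) ^ n. *)
Lemma iter_FopE m1 m2 x n n1 n2 :
  iter n (Fop m1 m2) x n1 n2 =
  qf n * \sum_(z < n.+1)
    Q (- ((n - z)%:R * (2 * (m1 - n1%:R) + z%:R))) *
    (fcprod m1 n1 z * fcprod m2 n2 (n - z)) / (qf z * qf (n - z)) *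
    x (n1 - z)%N (n2 - (n - z))%N.
Proof.
elim: n n1 n2 => [|n IH] n1 n2.
  rewrite big_ord1 /= /fcprod !big_ord0 /qf !big_nil !mul1r !mul0r oppr0 Q0.
  by rewrite !subn0 divr1 !mul1r.
pose T (z : nat) := Q (- ((n.+1 - z)%:R * (2 * (m1 - n1%:R) + z%:R))) *
    (fcprod m1 n1 z * fcprod m2 n2 (n.+1 - z)) / (qf z * qf (n.+1 - z)) *
    x (n1 - z)%N (n2 - (n.+1 - z))%N.
rewrite iterS /Fop !IH; under [in RHS]eq_bigr => z _ do rewrite -/(T z).
(* q-Pascal rule: [n+1] = [z] q^-(n+1-z) + [n+1-z] q^z. The first share, with [z] shifted by one,
   matches F (x) 1, the second K^-1 (x) F. *)
have -> : qf n.+1 * (\sum_(z < n.+2) T z) =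
   qf n * \sum_(z < n.+2) (br z%:R * Q (- (n.+1 - z)%:R) * T z +
                           br (n.+1 - z)%:R * Q z%:R * T z).
  rewrite qfS -mulrA; congr (_ * _); rewrite mulr_sumr; apply: eq_bigr => z _.
  rewrite -mulrDl; congr (_ * _).
  have zn : (z <= n.+1)%N by rewrite -ltnS.
  by rewrite -{1}(subnK zn) natrD brD addrC; congr (_ + _); rewrite mulrC.
rewrite big_split /= [in RHS]mulrDr; congr (_ + _).
  rewrite [in RHS]big_ord_recl /= mulr0n br0 !mul0r add0r mulrCA; congr (_ * _).
  rewrite mulr_sumr; apply: eq_bigr => z _; rewrite {}/T /bump /= add1n subSS fcprodS.
  case: n1 => [|n1]; first by rewrite !(mul0r, mulr0).
  have -> : Q (- ((n - z)%:R * (2 * (m1 - n1%:R) + z%:R))) =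
    Q (- (n - z)%:R) * Q (- ((n - z)%:R * (2 * (m1 - n1.+1%:R) + z.+1%:R))).
    by rewrite -QD -!natr1; congr Q; ring.
  rewrite qfS subSS /=.
  have := br_nat z; have := qf_neq0 z; have := qf_neq0 (n - z).
  move: (br z.+1%:R) (qf z) (qf (n - z)) => A B C hA hB hC.
  by field; apply/and3P; split.
rewrite [in RHS]big_ord_recr /= subnn mulr0n br0 !mul0r addr0 mulrCA; congr (_ * _).
rewrite mulr_sumr; apply: eq_bigr => z _; rewrite {}/T /=.
have zn : (z <= n)%N by rewrite -ltnS.
rewrite subSn // fcprodS qfS.
case: n2 => [|n2]; first by rewrite !(mul0r, mulr0).
have -> : Q (- ((n - z).+1%:R * (2 * (m1 - n1%:R) + z%:R))) =
    Q (- z%:R) * Q (- (2 * (m1 - n1%:R))) *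
    Q (- ((n - z)%:R * (2 * (m1 - n1%:R) + z%:R))).
  by rewrite -!QD -!natr1; congr Q; ring.
rewrite subSS /= (QN z%:R).
have := br_nat (n - z); have := qf_neq0 z; have := qf_neq0 (n - z).
have := Q_neq0 z%:R; move: (Q z%:R).
move: (br (n - z).+1%:R) (qf z) (qf (n - z)) => A B C D hA hB hC hD.
by field; apply/and4P; split.
Qed.

(** The singular vector of weight m1 + m2 - J: its coordinates are the q3j-symbols at a = mu,
    stripped of (-1)^(J/2) and Delta. *)
Definition sing (m2 : K) (J k l : nat) : K :=
  if (k + l)%N == J then
    (-1) ^+ k * Q (m2 ^+ 2 - (m2 - l%:R) ^+ 2 - k%:R) / (qf k * qf l)
  else 0.

Lemma sing_supp m2 J k l : (k + l)%N != J -> sing m2 J k l = 0.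
Proof. by rewrite /sing => /negbTE ->. Qed.

Lemma Eop_sing m2 J n1 n2 : Eop m2 (sing m2 J) n1 n2 = 0.
Proof.
rewrite /Eop /sing addSn addnS; case: eqP => _; last by rewrite !mulr0 addr0.
rewrite !qfS exprS.
have -> : Q (m2 ^+ 2 - (m2 - n2.+1%:R) ^+ 2 - n1%:R) =
  Q (2 * (m2 - n2%:R)) * Q (m2 ^+ 2 - (m2 - n2%:R) ^+ 2 - n1.+1%:R).
  by rewrite -QD -!natr1; congr Q; ring.
have := br_nat n1; have := br_nat n2; have := qf_neq0 n1; have := qf_neq0 n2.
move: (br n1.+1%:R) (br n2.+1%:R) (qf n1) (qf n2) => A B C D hA hB hC hD.
by field; apply/and4P; split.
Qed.

(** With [br_nat], irreducibility of the Verma module of highest weight [m]: F kills no basis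
    vector. *)
Definition good (m : K) : Prop := forall k : nat, br (2 * m - k%:R) != 0.

Lemma goodB m n : good m -> good (m - n%:R).
Proof.
move=> gm k; have := gm (2 * n + k)%N.
by congr (br _ != 0); rewrite natrD natrM; ring.
Qed.

Lemma fc_neq0 m k : good m -> fc m k.+1 != 0.
Proof. exact. Qed.

Variable scal : K -> K -> nat -> K.

(** Image of v_n under an embedding of M_m, m = m1 + m2 - J, with n = n1 + n2 - J forced by the
    degree. The denominator is the scalar in F^n v_0 = [2m] ... [2m-n+1] v_n; the normalisation
    [scal] will be (-1)^(J/2) Delta. *)
Definition cg (m1 m2 : K) (J n1 n2 : nat) : K :=
  scal m1 m2 J * iter (n1 + n2 - J) (Fop m1 m2) (sing m2 J) n1 n2 /
  \prod_(k < n1 + n2 - J) br (2 * (m1 + m2 - J%:R) - k%:R).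

Lemma cg_lt m1 m2 J n1 n2 : (n1 + n2 < J)%N -> cg m1 m2 J n1 n2 = 0.
Proof.
move=> lt; rewrite /cg (eqP (ltnW lt : (n1 + n2 - J == 0)%N)) /=.
by rewrite sing_supp ?mulr0 ?mul0r // neq_ltn lt.
Qed.

(** The embedding commutes with F: one more F costs exactly the next factor of the denominator. *)
Lemma cgF m1 m2 J n1 n2 : good (m1 + m2) ->
  fc (m1 + m2 - J%:R) (n1 + n2 - J) * cg m1 m2 J n1 n2 =
  Fop m1 m2 (cg m1 m2 J) n1 n2.
Proof.
move=> g12; have gm := goodB J g12.
have [le|lt] := leqP (n1 + n2) J.
  rewrite (eqP (le : (n1 + n2 - J == 0)%N)) mul0r /Fop.
  have -> : fc m1 n1 * cg m1 m2 J n1.-1 n2 = 0.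
    by case: n1 le => [|n1] le; rewrite ?mul0r //= cg_lt ?mulr0.
  rewrite -mulrA [X in Q _ * X](_ : _ = 0) ?mulr0 ?addr0 //.
  by case: n2 le => [|n2]; rewrite ?mul0r // addnS => le; rewrite cg_lt ?mulr0.
have [n Dn] : exists n, (n1 + n2 - J)%N = n.+1 by exists (n1 + n2 - J).-1; lia.
set P : K := \prod_(k < n) br (2 * (m1 + m2 - J%:R) - k%:R).
have -> : Fop m1 m2 (cg m1 m2 J) n1 n2 =
  scal m1 m2 J / P * Fop m1 m2 (iter n (Fop m1 m2) (sing m2 J)) n1 n2.
  rewrite -Fop_lin /Fop; congr (_ + _).
    case: n1 lt Dn => [|n1] lt Dn; first by rewrite !mul0r.
    by rewrite {1}/cg /= (_ : (n1 + n2 - J)%N = n) /P; [ring | lia].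
  case: n2 lt Dn => [|n2] lt Dn; first by rewrite !(mulr0, mul0r).
  by rewrite {1}/cg /= (_ : (n1 + n2 - J)%N = n) /P; [ring | lia].
rewrite /cg Dn -iterS big_ord_recr /= -/P.
have P0 : P != 0 by apply/prodf_neq0 => k _; apply: gm.
move: P P0 (gm n) => P P0 b0.
by move: (br _) b0 (Fop _ _ _ _ _) => b b0 y; field; apply/andP.
Qed.

(** The embedding commutes with E, by [Eop_iter_Fop]; in degree [J - 1] this is the singularity of
    [sing]. *)
Lemma cgE m1 m2 J n1 n2 : good (m1 + m2) ->
  Eop m2 (cg m1 m2 J) n1 n2 = br ((n1 + n2).+1%:R - J%:R) * cg m1 m2 J n1 n2.
Proof.
move=> g12; have gm := goodB J g12.
set P := fun n => \prod_(k < n) br (2 * (m1 + m2 - J%:R) - k%:R).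
have -> : Eop m2 (cg m1 m2 J) n1 n2 = scal m1 m2 J / P ((n1 + n2).+1 - J)%N *
    Eop m2 (iter ((n1 + n2).+1 - J) (Fop m1 m2) (sing m2 J)) n1 n2.
  rewrite /Eop /cg !addSn !addnS /P.
  by ring.
have [lt|le] := ltnP (n1 + n2) J.
  rewrite cg_lt // mulr0 (eqP (lt : ((n1 + n2).+1 - J == 0)%N)).
  by rewrite Eop_sing mulr0.
rewrite subSn // (Eop_iter_Fop _ (@sing_supp m2 J) (Eop_sing m2 J)).
rewrite /cg /P big_ord_recr /= -natrB ?leqW // subSn //.
set p := \prod_(_ < _) _; have p0 : p != 0 by apply/prodf_neq0 => k _; apply: gm.
move: (br (2 * _ - _)) (gm (n1 + n2 - J)%N) => b b0.
by move: p p0 => p p0; field; apply/andP.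
Qed.

Lemma cg_sing_neq0 m1 m2 J : scal m1 m2 J != 0 -> cg m1 m2 J 0 J != 0.
Proof.
move=> s0; rewrite /cg add0n subnn big_ord0 /= /sing add0n eqxx.
by rewrite !mulf_neq0 ?invr_eq0 ?mulf_neq0 ?oner_eq0 ?Q_neq0 ?qf_neq0 ?oner_neq0.
Qed.

Hypothesis scal_neq0 : forall m1 m2 J,
  good m1 -> good m2 -> good (m1 + m2) -> scal m1 m2 J != 0.

(** * Tensor products of two and three Verma modules *)

Section TwoFold.
Variables m1 m2 : K.
Hypotheses (g1 : good m1) (g2 : good m2) (g12 : good (m1 + m2)).

(* Applying E kills the last term and, on the others, only rescales the
   coefficients. *)
Lemma cg_free (B t : nat) (y : nat -> K) :
  (forall n1 n2, (n1 + n2)%N = t -> \sum_(j < B) y j * cg m1 m2 j n1 n2 = 0) ->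
  forall j, (j < B)%N -> (j <= t)%N -> y j = 0.
Proof.
(* At coordinate (0, t') the terms [j > t'] vanish by degree and the terms [j < t'] by assumption;
   the remaining one has a nonzero leading coefficient. *)
have last_coef t' (z : nat -> K) :
    (forall n1 n2, (n1 + n2)%N = t' -> \sum_(j < B) z j * cg m1 m2 j n1 n2 = 0) ->
    (forall j, (j < B)%N -> (j < t')%N -> z j = 0) ->
    (t' < B)%N -> z t' = 0.
  move=> hz z0 tB; have := hz 0%N t' (add0n _).
  rewrite (bigD1 (Ordinal tB)) //= big1 ?addr0 => [/eqP|j jt].
    by rewrite mulf_eq0 (negbTE (cg_sing_neq0 (scal_neq0 _ g1 g2 g12))) orbF => /eqP.
  have [lt|gt|eq] := ltngtP j t'; first by rewrite z0 ?mul0r.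
    by rewrite cg_lt ?mulr0.
  by case/eqP: jt; apply: val_inj.
elim: t y => [|t IH] y hy j jB jt.
  have j0 : j = 0%N by lia.
  by move: jB; rewrite j0; apply: last_coef.
(* E passes from degree [t.+1] to [t] and multiplies the [i]-th coefficient by [t + 1 - i], nonzero
   for [i <= t]. *)
have lower i : (i < B)%N -> (i <= t)%N -> y i = 0.
  move=> iB it; have /eqP : y i * br (t.+1%:R - i%:R) = 0.
    apply: (IH (fun i => y i * br (t.+1%:R - i%:R))) => // n1 n2 n12.
    rewrite (eq_bigr (fun k : 'I_B => y k * Eop m2 (cg m1 m2 k) n1 n2)); last first.
      by move=> k _; rewrite cgE // n12 mulrA.
    under eq_bigr => k _ do rewrite mulrDr.
    rewrite big_split /= -[RHS](addr0 0); congr (_ + _).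
      rewrite -[RHS](mulr0 (br n1.+1%:R * Q (2 * (m2 - n2%:R)))).
      rewrite -[0 in RHS](hy n1.+1 n2) ?addSn ?n12 // mulr_sumr.
      by apply: eq_bigr => k _; ring.
    rewrite -[RHS](mulr0 (br n2.+1%:R)) -[0 in RHS](hy n1 n2.+1) ?addnS ?n12 // mulr_sumr.
    by apply: eq_bigr => k _; ring.
  by rewrite mulf_eq0 -natrB ?leqW // subSn // (negbTE (br_nat _)) orbF => /eqP.
move: jt; rewrite leq_eqVlt => /orP[/eqP jt|]; last exact: lower.
by move: jB; rewrite jt; apply: last_coef.
Qed.

(** Dimension count: the weight space has [t.+1] basis vectors, so independence makes the square
    matrix [M] invertible. *)
Lemma cg_span (t : nat) (x : nat -> nat -> K) :
  exists y : nat -> K, forall n1 n2, (n1 + n2)%N = t ->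
    x n1 n2 = \sum_(j < t.+1) y j * cg m1 m2 j n1 n2.
Proof.
pose M := \matrix_(j < t.+1, i < t.+1) cg m1 m2 j i (t - i).
have M_unit : M \in unitmx.
  rewrite -row_free_unit; apply: inj_row_free => v vM0.
  have hv n1 n2 : (n1 + n2)%N = t ->
      \sum_(j < t.+1) v 0 (inord j) * cg m1 m2 j n1 n2 = 0.
    move=> n12; have n1t : (n1 < t.+1)%N by lia.
    have /matrixP/(_ 0 (Ordinal n1t)) := vM0; rewrite !mxE => e; rewrite -[RHS]e.
    apply: eq_bigr => j _; rewrite mxE inord_val /=.
    by congr (_ * cg _ _ _ _ _); lia.
  apply/rowP => j; rewrite mxE.
  have := cg_free (y := fun j => v 0 (inord j)) hv (ltn_ord j) (leq_ord j).
  by rewrite inord_val.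
pose v := \row_(i < t.+1) x i (t - i)%N.
have := mulmxKV M_unit v; move: (v *m invmx M) => u uM.
exists (fun j => u 0 (inord j)) => n1 n2 n12; have n1t : (n1 < t.+1)%N by lia.
have /matrixP/(_ 0 (Ordinal n1t)) := uM; rewrite !mxE /=.
have -> : (t - n1)%N = n2 by lia.
move <-; apply: eq_bigr => j _; rewrite mxE inord_val /=.
by congr (_ * cg _ _ _ _ _); lia.
Qed.

End TwoFold.

(** * Threefold products and recoupling *)

Definition Eop3 (m2 m3 : K) (x : nat -> nat -> nat -> K) (n1 n2 n3 : nat) : K :=
  br n1.+1%:R * Q (2 * (m2 - n2%:R)) * Q (2 * (m3 - n3%:R)) * x n1.+1 n2 n3 +
  br n2.+1%:R * Q (2 * (m3 - n3%:R)) * x n1 n2.+1 n3 +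
  br n3.+1%:R * x n1 n2 n3.+1.

Definition Fop3 (m1 m2 m3 : K) (x : nat -> nat -> nat -> K) (n1 n2 n3 : nat) : K :=
  fc m1 n1 * x n1.-1 n2 n3 +
  Q (- (2 * (m1 - n1%:R))) * fc m2 n2 * x n1 n2.-1 n3 +
  Q (- (2 * (m1 - n1%:R))) * Q (- (2 * (m2 - n2%:R))) * fc m3 n3 * x n1 n2 n3.-1.

(** Bracketing (12)3, indexed by depths: [J] and [J'] are the drops of weight at the inner and the
    outer coupling. *)
Definition cg12 m1 m2 m3 J J' n1 n2 n3 : K :=
  cg (m1 + m2 - J%:R) m3 J' (n1 + n2 - J) n3 * cg m1 m2 J n1 n2.

Definition cg23 m1 m2 m3 j j' n1 n2 n3 : K :=
  cg m1 (m2 + m3 - j%:R) j' n1 (n2 + n3 - j) * cg m2 m3 j n2 n3.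

Section ThreeFold.
Variables m1 m2 m3 : K.
Hypotheses (g1 : good m1) (g2 : good m2) (g3 : good m3).
Hypotheses (g12 : good (m1 + m2)) (g23 : good (m2 + m3)).
Hypothesis g123 : good (m1 + m2 + m3).

(** Equivariance of the inner, then of the outer embedding. Below degree [J] the truncated
    [n1 + n2 - J] is wrong, but there the inner factor vanishes. The next three lemmas follow this
    pattern. *)
Lemma cg12E J J' n1 n2 n3 :
  Eop3 m2 m3 (cg12 m1 m2 m3 J J') n1 n2 n3 =
  br ((n1 + n2 + n3).+1%:R - (J + J')%:R) * cg12 m1 m2 m3 J J' n1 n2 n3.
Proof.
have -> : Eop3 m2 m3 (cg12 m1 m2 m3 J J') n1 n2 n3 =
   Q (2 * (m3 - n3%:R)) * cg (m1 + m2 - J%:R) m3 J' ((n1 + n2).+1 - J) n3 *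
     Eop m2 (cg m1 m2 J) n1 n2 +
   br n3.+1%:R * cg (m1 + m2 - J%:R) m3 J' (n1 + n2 - J) n3.+1 * cg m1 m2 J n1 n2.
  by rewrite /Eop3 /Eop /cg12 !addSn !addnS; ring.
rewrite cgE // /cg12; have [lt|le] := ltnP (n1 + n2) J.
  by rewrite (cg_lt _ _ lt) !mulr0 addr0.
rewrite subSn // [X in X + _]mulrA [RHS]mulrA -mulrDl; congr (_ * _).
have -> : (n1 + n2 + n3).+1%:R - (J + J')%:R =
          (n1 + n2 - J + n3).+1%:R - J'%:R :> K.
  by rewrite !natrD -!natr1 !natrD natrB // natrD; ring.
rewrite -cgE; last first.
  by rewrite addrAC; apply: goodB.
by rewrite /Eop -natrB ?leqW // subSn //; ring.
Qed.

Lemma cg23E j j' n1 n2 n3 :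
  Eop3 m2 m3 (cg23 m1 m2 m3 j j') n1 n2 n3 =
  br ((n1 + n2 + n3).+1%:R - (j + j')%:R) * cg23 m1 m2 m3 j j' n1 n2 n3.
Proof.
have -> : Eop3 m2 m3 (cg23 m1 m2 m3 j j') n1 n2 n3 =
   br n1.+1%:R * Q (2 * (m2 + m3 - (n2 + n3)%:R)) *
     cg m1 (m2 + m3 - j%:R) j' n1.+1 (n2 + n3 - j) * cg m2 m3 j n2 n3 +
   cg m1 (m2 + m3 - j%:R) j' n1 ((n2 + n3).+1 - j) * Eop m3 (cg m2 m3 j) n2 n3.
  have -> : Q (2 * (m2 + m3 - (n2 + n3)%:R)) =
    Q (2 * (m2 - n2%:R)) * Q (2 * (m3 - n3%:R)).
    by rewrite -QD natrD; congr Q; ring.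
  by rewrite /Eop3 /Eop /cg23 !addSn !addnS; ring.
rewrite cgE // /cg23; have [lt|le] := ltnP (n2 + n3) j.
  by rewrite (cg_lt _ _ lt) !mulr0 addr0.
rewrite subSn // [X in _ + X]mulrA [RHS]mulrA -mulrDl; congr (_ * _).
have -> : (n1 + n2 + n3).+1%:R - (j + j')%:R =
          (n1 + (n2 + n3 - j)).+1%:R - j'%:R :> K.
  by rewrite !natrD -!natr1 !natrD natrB // natrD; ring.
rewrite -cgE; last by rewrite !addrA; apply: goodB.
rewrite /Eop -natrB ?leqW // subSn //.
have -> : m2 + m3 - (n2 + n3)%:R = m2 + m3 - j%:R - (n2 + n3 - j)%:R.
  by rewrite natrB //; ring.
by ring.
Qed.

Lemma cg12F J J' n1 n2 n3 :
  Fop3 m1 m2 m3 (cg12 m1 m2 m3 J J') n1 n2 n3 =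
  fc (m1 + m2 + m3 - (J + J')%:R) (n1 + n2 + n3 - (J + J')) *
  cg12 m1 m2 m3 J J' n1 n2 n3.
Proof.
have -> : Fop3 m1 m2 m3 (cg12 m1 m2 m3 J J') n1 n2 n3 =
  cg (m1 + m2 - J%:R) m3 J' (n1 + n2 - J).-1 n3 * Fop m1 m2 (cg m1 m2 J) n1 n2 +
  Q (- (2 * (m1 + m2 - (n1 + n2)%:R))) * fc m3 n3 *
  cg (m1 + m2 - J%:R) m3 J' (n1 + n2 - J) n3.-1 * cg m1 m2 J n1 n2.
  have -> : Q (- (2 * (m1 + m2 - (n1 + n2)%:R))) =
    Q (- (2 * (m1 - n1%:R))) * Q (- (2 * (m2 - n2%:R))).
    by rewrite -QD natrD; congr Q; ring.
  rewrite /Fop3 /Fop /cg12 mulrDr predn_sub.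
  case: n1 n2 => [|n1] [|n2] //=; rewrite ?addSn ?addnS /=; ring.
rewrite -cgF // /cg12; have [lt|le] := ltnP (n1 + n2) J.
  by rewrite (cg_lt _ _ lt) !mulr0 addr0.
rewrite [X in X + _]mulrA [RHS]mulrA -mulrDl; congr (_ * _).
have -> : m1 + m2 + m3 - (J + J')%:R = m1 + m2 - J%:R + m3 - J'%:R.
  by rewrite natrD; ring.
have -> : (n1 + n2 + n3 - (J + J'))%N = (n1 + n2 - J + n3 - J')%N by lia.
rewrite cgF; last by rewrite addrAC; apply: goodB.
rewrite /Fop; have -> : m1 + m2 - (n1 + n2)%:R = m1 + m2 - J%:R - (n1 + n2 - J)%:R.
  by rewrite natrB //; ring.
by ring.
Qed.

Lemma cg23F j j' n1 n2 n3 :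
  Fop3 m1 m2 m3 (cg23 m1 m2 m3 j j') n1 n2 n3 =
  fc (m1 + m2 + m3 - (j + j')%:R) (n1 + n2 + n3 - (j + j')) *
  cg23 m1 m2 m3 j j' n1 n2 n3.
Proof.
have -> : Fop3 m1 m2 m3 (cg23 m1 m2 m3 j j') n1 n2 n3 =
  fc m1 n1 * cg m1 (m2 + m3 - j%:R) j' n1.-1 (n2 + n3 - j) * cg m2 m3 j n2 n3 +
  Q (- (2 * (m1 - n1%:R))) * cg m1 (m2 + m3 - j%:R) j' n1 (n2 + n3 - j).-1 *
  Fop m2 m3 (cg m2 m3 j) n2 n3.
  rewrite /Fop3 /Fop /cg23 mulrDr predn_sub.
  case: n2 n3 => [|n2] [|n3] //=; rewrite ?addSn ?addnS /=; ring.
rewrite -cgF // /cg23; have [lt|le] := ltnP (n2 + n3) j.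
  by rewrite (cg_lt _ _ lt) !mulr0 addr0.
rewrite [X in _ + X]mulrA [RHS]mulrA -mulrDl; congr (_ * _).
have -> : m1 + m2 + m3 - (j + j')%:R = m1 + (m2 + m3 - j%:R) - j'%:R.
  by rewrite natrD; ring.
have -> : (n1 + n2 + n3 - (j + j'))%N = (n1 + (n2 + n3 - j) - j')%N by lia.
rewrite cgF; last by rewrite !addrA; apply: goodB.
by rewrite /Fop; ring.
Qed.

Lemma Eop3_linear (B : nat) (c : nat -> K) x (y : nat -> nat -> nat -> nat -> K) n1 n2 n3 :
  Eop3 m2 m3 (fun k1 k2 k3 => x k1 k2 k3 - \sum_(j < B) c j * y j k1 k2 k3) n1 n2 n3 =
  Eop3 m2 m3 x n1 n2 n3 - \sum_(j < B) c j * Eop3 m2 m3 (y j) n1 n2 n3.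
Proof.
have pull e (f : 'I_B -> K) : \sum_(j < B) c j * (e * f j) = e * \sum_(j < B) c j * f j.
  by rewrite mulr_sumr; apply: eq_bigr => j _; rewrite mulrCA.
rewrite /Eop3; under [in RHS]eq_bigr => j _ do rewrite mulrDr [X in X + _]mulrDr.
by rewrite !big_split /= !pull /=; ring.
Qed.

Lemma Fop3_linear (B : nat) (c : nat -> K) x (y : nat -> nat -> nat -> nat -> K) n1 n2 n3 :
  Fop3 m1 m2 m3 (fun k1 k2 k3 => x k1 k2 k3 - \sum_(j < B) c j * y j k1 k2 k3) n1 n2 n3 =
  Fop3 m1 m2 m3 x n1 n2 n3 - \sum_(j < B) c j * Fop3 m1 m2 m3 (y j) n1 n2 n3.
Proof.
have pull e (f : 'I_B -> K) : \sum_(j < B) c j * (e * f j) = e * \sum_(j < B) c j * f j.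
  by rewrite mulr_sumr; apply: eq_bigr => j _; rewrite mulrCA.
rewrite /Fop3; under [in RHS]eq_bigr => j _ do rewrite mulrDr [X in X + _]mulrDr.
by rewrite !big_split /= !pull /=; ring.
Qed.

Lemma cg12_lt J J' n1 n2 n3 :
  (n1 + n2 + n3 < J + J')%N -> cg12 m1 m2 m3 J J' n1 n2 n3 = 0.
Proof.
move=> lt; rewrite /cg12; have [lt'|le] := ltnP (n1 + n2) J.
  by rewrite (cg_lt _ _ lt') mulr0.
by rewrite cg_lt ?mul0r //; lia.
Qed.

Lemma cg23_lt j j' n1 n2 n3 :
  (n1 + n2 + n3 < j + j')%N -> cg23 m1 m2 m3 j j' n1 n2 n3 = 0.
Proof.
move=> lt; rewrite /cg23; have [lt'|le] := ltnP (n2 + n3) j.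
  by rewrite (cg_lt _ _ lt') mulr0.
by rewrite cg_lt ?mul0r //; lia.
Qed.

Lemma cg_slice_neq0 j N : cg m1 (m2 + m3 - j%:R) (N - j) 0 (N - j) != 0.
Proof.
apply/cg_sing_neq0/scal_neq0 => //; first exact: goodB.
by rewrite !addrA; apply: goodB.
Qed.

(** The total drop [J + J'] is common to both bracketings, so the depth [j] of (23) determines the
    outer one. Ranging over all coordinates makes [c] independent of the weight a. *)
Definition is_sixj J J' (c : nat -> K) : Prop := forall n1 n2 n3,
  cg12 m1 m2 m3 J J' n1 n2 n3 =
  \sum_(j < (J + J').+1) c j * cg23 m1 m2 m3 j (J + J' - j) n1 n2 n3.

(* Both families are F-equivariant, so it suffices to compare the singular
   vectors; these are determined by their slice n1 = 0, which lies in the span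
   of the vectors of weight N in M_{m2} (x) M_{m3}. *)
Lemma is_sixj_exists J J' : exists c, is_sixj J J' c.
Proof.
set N := (J + J')%N.
have [y hy] := cg_span g2 g3 g23 N (cg12 m1 m2 m3 J J' 0).
(* Division by the leading coefficient of the outer coupling makes both sides agree on the slice
   [n1 = 0]. *)
pose c j := y j / cg m1 (m2 + m3 - j%:R) (N - j) 0 (N - j).
exists c.
pose d n1 n2 n3 := cg12 m1 m2 m3 J J' n1 n2 n3 -
  \sum_(j < N.+1) c j * cg23 m1 m2 m3 j (N - j) n1 n2 n3.
suff d0 n1 n2 n3 : d n1 n2 n3 = 0 by move=> n1 n2 n3; apply/subr0_eq/d0.
have dE k1 k2 k3 : Eop3 m2 m3 d k1 k2 k3 =
    br ((k1 + k2 + k3).+1%:R - N%:R) * d k1 k2 k3.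
  rewrite [LHS](@Eop3_linear N.+1 c (cg12 m1 m2 m3 J J')
    (fun j => cg23 m1 m2 m3 j (N - j))).
  rewrite cg12E mulrBr mulr_sumr; congr (_ - _).
  by apply: eq_bigr => j _; rewrite cg23E subnKC; [apply: mulrCA | rewrite -ltnS].
have dF k1 k2 k3 : Fop3 m1 m2 m3 d k1 k2 k3 =
    fc (m1 + m2 + m3 - N%:R) (k1 + k2 + k3 - N) * d k1 k2 k3.
  rewrite [LHS](@Fop3_linear N.+1 c (cg12 m1 m2 m3 J J')
    (fun j => cg23 m1 m2 m3 j (N - j))).
  rewrite cg12F mulrBr mulr_sumr; congr (_ - _).
  by apply: eq_bigr => j _; rewrite cg23F subnKC; [apply: mulrCA | rewrite -ltnS].
(* E annihilates the degree [N] part of [d], its scalar being [0] = 0; this expresses coordinates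
   with first index [k1.+1] through those with [k1]. *)
have d_sing k1 k2 k3 : (k1 + k2 + k3)%N = N -> d k1 k2 k3 = 0.
  elim: k1 k2 k3 => [|k1 IH] k2 k3 eN.
    rewrite /d hy //; apply/eqP; rewrite subr_eq0; apply/eqP.
    apply: eq_bigr => j _; rewrite /cg23 -[(k2 + k3)%N]/(0 + k2 + k3)%N eN.
    by rewrite /c mulrA divfK ?cg_slice_neq0.
  have := dE k1 k2 k3; rewrite -!addSn eN subrr br0 mul0r /Eop3.
  rewrite (IH k2.+1) ?(IH _ k3.+1) ?mulr0 ?addr0 => [/eqP||]; try lia.
  have nz : br k1.+1%:R * Q (2 * (m2 - k2%:R)) * Q (2 * (m3 - k3%:R)) != 0.
    by apply: mulf_neq0 (Q_neq0 _); apply: mulf_neq0 (br_nat _) (Q_neq0 _).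
  by rewrite mulf_eq0 (negbTE nz) => /eqP.
have d_lt k1 k2 k3 : (k1 + k2 + k3 < N)%N -> d k1 k2 k3 = 0.
  move=> lt; rewrite /d cg12_lt // big1 ?subr0 // => j _.
  by rewrite cg23_lt ?mulr0 // subnKC // -ltnS.
(* Above degree [N], F expresses a nonzero multiple of each coordinate through coordinates of the
   previous degree. *)
elim: {n1 n2 n3}(n1 + n2 + n3)%N {-2}n1 {-2}n2 {-2}n3 (erefl (n1 + n2 + n3)%N)
  => [|s IH] n1 n2 n3 es.
  by have [lt|gt|] := ltngtP (n1 + n2 + n3)%N N; [exact: d_lt | lia | exact: d_sing].
have [lt|gt|] := ltngtP (n1 + n2 + n3)%N N; [exact: d_lt | | exact: d_sing].
have /eqP := dF n1 n2 n3; rewrite /Fop3.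
have -> : fc m1 n1 * d n1.-1 n2 n3 = 0.
  by case: n1 es {gt} => [|n1] es; rewrite ?mul0r // IH ?mulr0 //=; lia.
have -> e : e * fc m2 n2 * d n1 n2.-1 n3 = 0.
  by case: n2 es {gt} => [|n2] es; rewrite ?mulr0 ?mul0r // IH ?mulr0 //=; lia.
have -> e : e * fc m3 n3 * d n1 n2 n3.-1 = 0.
  by case: n3 es {gt} => [|n3] es; rewrite ?mulr0 ?mul0r // IH ?mulr0 //=; lia.
rewrite !addr0 eq_sym mulf_eq0 => /orP[|/eqP //].
have -> : (n1 + n2 + n3 - N)%N = (n1 + n2 + n3 - N).-1.+1 by lia.
by rewrite (negbTE (fc_neq0 _ (goodB _ g123))).
Qed.

(** On the slice [n1 = 0] in degree [N], the difference of the two expansions is a vanishing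
    combination of independent vectors. *)
Lemma is_sixj_unique J J' c c' : is_sixj J J' c -> is_sixj J J' c' ->
  forall j, (j <= J + J')%N -> c j = c' j.
Proof.
set N := (J + J')%N => hc hc' j jN; apply/eqP; rewrite -subr_eq0.
pose y j := (c j - c' j) * cg m1 (m2 + m3 - j%:R) (N - j) 0 (N - j).
have /eqP : y j = 0.
  apply: (cg_free g2 g3 g23 (B := N.+1) (t := N) (y := y)) => // n2 n3 eN.
  transitivity (cg12 m1 m2 m3 J J' 0 n2 n3 - cg12 m1 m2 m3 J J' 0 n2 n3).
    rewrite {1}hc hc' -sumrB; apply: eq_bigr => i _.
    by rewrite /y /cg23 eN; ring.
  by rewrite subrr.
by rewrite mulf_eq0 (negbTE (cg_slice_neq0 _ _)) orbF.
Qed.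

End ThreeFold.

(** * Reindexing of finite sums *)

Lemma sum_shift (a n : nat) (G : nat -> K) : (a <= n)%N ->
  \sum_(i < (n - a).+1) G (a + i)%N = \sum_(t < n.+1 | (a <= t)%N) G t.
Proof.
move=> an; rewrite -(big_geq_mkord a n.+1 xpredT) /=.
rewrite -subSn // (_ : \sum_(a <= t < n.+1) G t = \sum_(0 + a <= t < n.+1) G t) //.
rewrite big_addn big_mkord.
by apply: eq_bigr => i _; rewrite addnC.
Qed.

(** In the pentagon, [p], [t = j + i] and [j] are the depths of (34), (234) and (23); the last is to
    be summed innermost. *)
Lemma sum_triangle (P N : nat) (H : nat -> nat -> nat -> nat -> K) : (P <= N)%N ->
  \sum_(j < P.+1) \sum_(i < (N - j).+1) \sum_(p < (j + i).+1) H j i p (j + i)%N =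
  \sum_(p < N.+1) \sum_(t < N.+1 | (p <= t)%N)
    \sum_(j < P.+1 | (j <= t)%N) H j (t - j)%N p t.
Proof.
move=> PN.
transitivity (\sum_(j < P.+1) \sum_(t < N.+1 | (j <= t)%N)
    \sum_(p < N.+1 | (p <= t)%N) H j (t - j)%N p t).
  apply: eq_bigr => j _; have jN : (j <= N)%N by rewrite (leq_trans _ PN) // -ltnS.
  rewrite -(sum_shift (fun t => \sum_(p < N.+1 | (p <= t)%N) H j (t - j)%N p t)) //.
  apply: eq_bigr => i _; rewrite addKn.
  rewrite (big_ord_widen N.+1 (fun p => H j i p (j + i)%N)) //.
  by have := ltn_ord i; lia.
rewrite (exchange_big_dep xpredT) //=.
under eq_bigr => t _ do rewrite exchange_big /=.
by rewrite (exchange_big_dep xpredT).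
Qed.

(** * The pentagon *)

Section FourFold.
Variables m1 m2 m3 m4 : K.
Hypotheses (g1 : good m1) (g2 : good m2) (g3 : good m3) (g4 : good m4).
Hypotheses (g34 : good (m3 + m4)) (g234 : good (m2 + m3 + m4)).
Hypothesis g1234 : good (m1 + m2 + m3 + m4).

Definition cg234 (N p t n1 n2 n3 n4 : nat) : K :=
  cg m1 (m2 + m3 + m4 - t%:R) (N - t) n1 (n2 + n3 + n4 - t) *
  cg23 m2 m3 m4 p (t - p) n2 n3 n4.

(** [cg_free] in factors 3 and 4 separates the values of [p]; then, on the slice [n1 = 0], [cg_free]
    for factor 2 and the coupled pair (34) separates the values of [t]. *)
Lemma cg234_free N (y : nat -> nat -> K) :
  (forall n1 n2 n3 n4,
    \sum_(p < N.+1) \sum_(t < N.+1 | (p <= t)%N) y p t * cg234 N p t n1 n2 n3 n4 = 0) ->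
  forall p t, (p <= t)%N -> (t <= N)%N -> y p t = 0.
Proof.
move=> hy p t pt tN.
have pN : (p < N.+1)%N by lia.
(* All of a term except its coupling of 3 and 4. The degree in these factors is written [k + p],
   which puts [p] in the range of [cg_free]. *)
pose Y n1 n2 k p' t' := y p' t' *
  (cg m1 (m2 + m3 + m4 - t'%:R) (N - t') n1 (n2 + (k + p) - t') *
   cg m2 (m3 + m4 - p'%:R) (t' - p') n2 (k + p - p')).
have step n1 n2 k : \sum_(t' < N.+1 | (p <= t')%N) Y n1 n2 k p t' = 0.
  apply: (cg_free g3 g4 g34 (B := N.+1) (t := (k + p)%N)
    (y := fun p' => \sum_(t' < N.+1 | (p' <= t')%N) Y n1 n2 k p' t')) => //; last first.
    exact: leq_addl.
  move=> n3 n4 e34; rewrite -[RHS](hy n1 n2 n3 n4); apply: eq_bigr => p' _.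
  rewrite mulr_suml; apply: eq_bigr => t' _.
  by rewrite /Y /cg234 /cg23 -addnA e34 !mulrA.
pose z r := y p (p + r)%N *
  cg m1 (m2 + m3 + m4 - (p + r)%:R) (N - (p + r)) 0 (N - (p + r)).
have /eqP : z (t - p)%N = 0.
  apply: (cg_free (m2 := m3 + m4 - p%:R) g2 _ _ (B := (N - p).+1) (t := (N - p)%N) (y := z)).
  - exact: goodB.
  - by rewrite !addrA; apply: goodB.
  - move=> n2 k e2k; rewrite -[RHS](step 0%N n2 k).
    rewrite -(sum_shift (fun t' => Y 0%N n2 k p t')) //.
    apply: eq_bigr => r _; rewrite /z /Y addnK addKn -mulrA.
    by congr (_ * (cg _ _ _ _ _ * _)); lia.
  - by lia.
  by lia.
rewrite /z subnKC // mulf_eq0 => /orP[/eqP//|].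
rewrite (negbTE (cg_sing_neq0 _)) //; apply: scal_neq0 => //; first exact: goodB.
by rewrite !addrA; apply: goodB.
Qed.

(** From ((12)3)4 to 1(2(34)) by two routes: through (1(23))4 and 1((23)4), with coefficients [a],
    [b], [d], or through (12)(34), with [g], [f]. *)
Lemma pentagon p12 p3 p4 (a g : nat -> K) (b f : nat -> nat -> K) (d : nat -> nat -> nat -> K) :
  let N := (p12 + p3 + p4)%N in
  is_sixj m1 m2 m3 p12 p3 a ->
  (forall j, (j <= p12 + p3)%N ->
     is_sixj m1 (m2 + m3 - j%:R) m4 (p12 + p3 - j) p4 (b j)) ->
  (forall j i, is_sixj m2 m3 m4 j i (d j i)) ->
  is_sixj (m1 + m2 - p12%:R) m3 m4 p3 p4 g ->
  (forall p, (p <= p3 + p4)%N ->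
     is_sixj m1 m2 (m3 + m4 - p%:R) p12 (p3 + p4 - p) (f p)) ->
  forall p t, (p <= t)%N -> (t <= N)%N -> (p <= p3 + p4)%N ->
  \sum_(j < (p12 + p3).+1 | (j <= t)%N) a j * b j (t - j)%N * d j (t - j)%N p =
  g p * f p (t - p)%N.
Proof.
move=> N ha hb hd hg hf p t pt tN pM.
pose A p t := \sum_(j < (p12 + p3).+1 | (j <= t)%N) a j * b j (t - j)%N * d j (t - j)%N p.
(* The route through (12)(34) only produces [p <= p3 + p4]; the coefficient is extended by zero. *)
pose B p t := if (p <= p3 + p4)%N then g p * f p (t - p)%N else 0.
suff /eqP : A p t - B p t = 0 by rewrite subr_eq0 /A /B pM => /eqP.
apply: (cg234_free (N := N) (y := fun p t => A p t - B p t)) => // n1 n2 n3 n4.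
pose L := cg (m1 + m2 + m3 - (p12 + p3)%:R) m4 p4 (n1 + n2 + n3 - (p12 + p3)) n4 *
          cg12 m1 m2 m3 p12 p3 n1 n2 n3.
pose X p t := cg234 N p t n1 n2 n3 n4.
have LA : L = \sum_(p < N.+1) \sum_(t < N.+1 | (p <= t)%N) A p t * X p t.
  transitivity (\sum_(j < (p12 + p3).+1) \sum_(i < (N - j).+1)
      \sum_(p < (j + i).+1) a j * b j i * d j i p * X p (j + i)%N).
    rewrite /L ha mulr_sumr; apply: eq_bigr => j _.
    have jP : (j <= p12 + p3)%N by rewrite -ltnS.
    set al := m2 + m3 - j%:R.
    (* Truncated subtraction would break the depth arithmetic here; both sides vanish because the
       degree in (23) is too low. *)
    have [lt|le] := ltnP (n2 + n3) j.
      rewrite {1}/cg23 (cg_lt _ _ lt) !mulr0 big1 // => i _.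
      transitivity (a j * b j i * cg m1 (m2 + m3 + m4 - (j + i)%:R) (N - (j + i))
        n1 (n2 + n3 + n4 - (j + i)) * cg12 m2 m3 m4 j i n2 n3 n4).
        rewrite hd mulr_sumr; apply: eq_bigr => p' _.
        by rewrite /X /cg234; ring.
      by rewrite /cg12 (cg_lt _ _ lt) !mulr0.
    transitivity (a j * (cg12 m1 al m4 (p12 + p3 - j) p4 n1 (n2 + n3 - j) n4 *
                         cg m2 m3 j n2 n3)).
      rewrite /cg12 /cg23.
      have -> : (n1 + (n2 + n3 - j) - (p12 + p3 - j) = n1 + n2 + n3 - (p12 + p3))%N.
        by lia.
      have -> : m1 + al - (p12 + p3 - j)%:R = m1 + m2 + m3 - (p12 + p3)%:R.
        by rewrite natrB // /al; ring.
      by ring.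
    rewrite hb // mulr_suml mulr_sumr.
    have -> : (p12 + p3 - j + p4)%N = (N - j)%N by rewrite /N; lia.
    apply: eq_bigr => i _.
    transitivity (a j * b j i * cg m1 (m2 + m3 + m4 - (j + i)%:R) (N - (j + i))
        n1 (n2 + n3 + n4 - (j + i)) * cg12 m2 m3 m4 j i n2 n3 n4).
      rewrite /cg12 /cg23 -/al.
      have -> : al + m4 - i%:R = m2 + m3 + m4 - (j + i)%:R.
        by rewrite natrD /al; ring.
      have -> : (n2 + n3 - j + n4 - i = n2 + n3 + n4 - (j + i))%N by lia.
      by rewrite -(subnDA j N i); ring.
    by rewrite hd mulr_sumr; apply: eq_bigr => p' _; rewrite /X /cg234; ring.
  rewrite (sum_triangle (fun j i p t => a j * b j i * d j i p * X p t)); last first.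
    by rewrite /N leq_addr.
  apply: eq_bigr => p' _; apply: eq_bigr => t' _.
  by rewrite /A mulr_suml.
have LB : L = \sum_(p < N.+1) \sum_(t < N.+1 | (p <= t)%N) B p t * X p t.
  have inner p' : (p' <= p3 + p4)%N -> g p' * cg m3 m4 p' n3 n4 *
      cg12 m1 m2 (m3 + m4 - p'%:R) p12 (p3 + p4 - p') n1 n2 (n3 + n4 - p') =
      \sum_(r < (N - p').+1) g p' * f p' r * X p' (p' + r)%N.
    move=> p'M; rewrite hf //.
    have -> : (p12 + (p3 + p4 - p'))%N = (N - p')%N by rewrite /N; lia.
    rewrite mulr_sumr; apply: eq_bigr => r _.
    rewrite /X /cg234 /cg23 addKn; have [lt|le] := ltnP (n3 + n4) p'.
      by rewrite (cg_lt _ _ lt) !(mulr0, mul0r).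
    have -> : (n2 + (n3 + n4 - p') - r = n2 + n3 + n4 - (p' + r))%N by lia.
    have -> : m2 + (m3 + m4 - p'%:R) - r%:R = m2 + m3 + m4 - (p' + r)%:R.
      by rewrite natrD; ring.
    by rewrite -(subnDA p' N r); ring.
  transitivity (\sum_(p < (p3 + p4).+1) \sum_(r < (N - p).+1)
      g p * f p r * X p (p + r)%N).
    have [lt|le] := ltnP (n1 + n2) p12.
      rewrite /L {1}/cg12 (cg_lt _ _ lt) !mulr0 big1 // => p' _.
      rewrite -inner; last by rewrite -ltnS.
      by rewrite /cg12 (cg_lt _ _ lt) !mulr0.
    transitivity (cg12 (m1 + m2 - p12%:R) m3 m4 p3 p4 (n1 + n2 - p12) n3 n4 *
                  cg m1 m2 p12 n1 n2).
      rewrite /L /cg12.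
      have -> : (n1 + n2 - p12 + n3 - p3 = n1 + n2 + n3 - (p12 + p3))%N by lia.
      have -> : m1 + m2 - p12%:R + m3 - p3%:R = m1 + m2 + m3 - (p12 + p3)%:R.
        by rewrite natrD; ring.
      by ring.
    rewrite hg mulr_suml; apply: eq_bigr => p' _.
    transitivity (g p' * cg m3 m4 p' n3 n4 *
      cg12 m1 m2 (m3 + m4 - p'%:R) p12 (p3 + p4 - p') n1 n2 (n3 + n4 - p')).
      by rewrite /cg12 /cg23; ring.
    by apply: inner; rewrite -ltnS.
  apply/esym; transitivity (\sum_(p < N.+1 | (p < (p3 + p4).+1)%N)
      \sum_(t < N.+1 | (p <= t)%N) g p * f p (t - p)%N * X p t).
    rewrite [RHS]big_mkcond; apply: eq_bigr => p' _; rewrite ltnS /B.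
    by case: ifP => // _; apply: big1 => t' _; rewrite mul0r.
  rewrite -(big_ord_widen N.+1 (fun p => \sum_(t < N.+1 | (p <= t)%N)
     g p * f p (t - p)%N * X p t)); last by rewrite /N -addnA ltnS leq_addl.
  apply: eq_bigr => p' _.
  rewrite -(sum_shift (fun t => g p' * f p' (t - p')%N * X p' t)); last first.
    by have := ltn_ord p'; rewrite /N; lia.
  by apply: eq_bigr => r _; rewrite addKn.
transitivity (L - L); last exact: subrr.
rewrite {1}LA LB -sumrB; apply: eq_bigr => p' _; rewrite -sumrB.
by apply: eq_bigr => t' _; rewrite mulrBl.
Qed.

End FourFold.

End QuantumNumbers.

(** * The complex case and the q3j- and q6j-symbols of the definitions *)

Section Symbols_over_C.
Variable R : realType.
Implicit Types (h x y m : R[i]).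

Lemma cexpD x y : cexp (x + y) = cexp x * cexp y.
Proof.
case: x y => [a b] [c d]; rewrite /cexp /= expRD cosD sinD rmorphM /=.
by apply/eqP; rewrite eq_complex /=; apply/andP; split; apply/eqP; ring.
Qed.

Lemma cexp0 : cexp (0 : R[i]) = 1.
Proof. by rewrite /cexp /= expR0 cos0 sin0 mul1r. Qed.

Lemma qpowD h x y : qpow h (x + y) = qpow h x * qpow h y.
Proof. by rewrite /qpow -cexpD; congr cexp; ring. Qed.

Lemma qpow0 h : qpow h 0 = 1.
Proof. by rewrite /qpow mulr0 mul0r cexp0. Qed.

Lemma signpowD x n : signpow (x + n%:R) = signpow x * (-1) ^+ n.
Proof.
elim: n => [|n IH]; first by rewrite addr0 expr0 mulr1.
rewrite -natr1 addrA exprSr mulrA -IH /signpow mulrDr cexpD mulr1; congr (_ * _).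
rewrite /cexp /= expR0 cospi sinpi mul1r.
by apply/eqP; rewrite eq_complex /= oppr0 !eqxx.
Qed.

Lemma signpow_neq0 x : signpow x != 0.
Proof.
have := cexpD ((0 +i* pi) * x) (- ((0 +i* pi) * x)).
rewrite subrr cexp0 -/(signpow x) => /esym e; apply/eqP => e0.
by move: e; rewrite e0 mul0r => /eqP; rewrite eq_sym oner_eq0.
Qed.

Lemma toN_nat n : toN (n%:R : R[i]) = n.
Proof.
by rewrite /toN -(rmorph_nat (real_complex R)) /= natrK.
Qed.

Lemma isNP x : reflect (exists n, x = n%:R) (isN x).
Proof.
by apply: (iffP eqP) => [->|[n ->]]; [exists (toN x) | rewrite toN_nat].
Qed.

Lemma isN_nat n : isN (n%:R : R[i]).
Proof. by apply/isNP; exists n. Qed.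

Lemma isN_natB n k : isN (n%:R - k%:R : R[i]) = (k <= n)%N.
Proof.
have [le|lt] := leqP k n; first by rewrite -natrB // isN_nat.
apply/isNP => -[j /eqP]; rewrite subr_eq -natrD eqr_nat; lia.
Qed.


Section Symbols.
Variables (h : R[i]) (D : R[i] -> R[i] -> R[i] -> R[i]).
Hypothesis br_nat : forall n, qnum h n.+1%:R != 0.

Definition cg_scal (m1 m2 : R[i]) (J : nat) : R[i] :=
  signpow (J%:R / 2) * D m1 m2 (m1 + m2 - J%:R).

Local Notation cgq := (cg (qpow h) cg_scal).
Local Notation goodq := (good (qpow h)).

(** At a = m - k one has m + a = 2m - k, so the rising product lists the coefficients met by F^z on
    its way to v_k. Past [z = k] the right side is 0 and the two may differ. *)
Lemma qrising_fcprod m k z : (z <= k)%N ->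
  qrising h (2 * m - k%:R) z = fcprod (qpow h) m k z.
Proof.
move=> zk; rewrite /qrising big_add1 big_mkord; apply: eq_bigr => i _.
have ik : (i < k)%N := leq_trans (ltn_ord i) zk.
have -> : (k - i)%N = (k - i.+1).+1 by rewrite subnSK.
by rewrite /= (natrB _ ik); congr qnum; ring.
Qed.

Lemma qrising_rev m n :
  qrising h (2 * m - n%:R) n = \prod_(k < n) qnum h (2 * m - k%:R).
Proof.
rewrite /qrising big_add1 big_mkord (reindex_inj rev_ord_inj) /=.
apply: eq_bigr => i _; rewrite subnSK //.
by rewrite natrB ?(ltnW (ltn_ord i)) //; congr qnum; ring.
Qed.

(** The defining sum is the expansion [iter_FopE] of F^n applied to [sing], matched term by term:
    [eQ] compares powers of q, [es] signs. *)
Lemma q3j_cg m1 m2 J n1 n2 a : a = m1 - n1%:R + (m2 - n2%:R) ->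
  q3j h D m1 m2 (m1 + m2 - J%:R) (m1 - n1%:R) (m2 - n2%:R) a =
  cgq m1 m2 J n1 n2.
Proof.
move=> {a}->; rewrite /q3j eqxx andbT.
have eJ : m1 + m2 - (m1 + m2 - J%:R) = J%:R by ring.
have e1 : m1 - (m1 - n1%:R) = n1%:R by ring.
have e2 : m2 - (m2 - n2%:R) = n2%:R by ring.
have e : m1 + m2 - J%:R - (m1 - n1%:R + (m2 - n2%:R)) = (n1 + n2)%:R - J%:R.
  by rewrite natrD; ring.
rewrite eJ e1 e2 e !isN_nat isN_natB /=.
case: leqP => [le|lt]; last by rewrite cg_lt.
rewrite -natrB // !toN_nat; set n := (n1 + n2 - J)%N.
have nE : n%:R = n1%:R + n2%:R - J%:R :> R[i] by rewrite natrB // natrD.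
rewrite /cg -/n (iter_FopE (@qpowD h) (qpow0 h) br_nat).
set m := m1 + m2 - J%:R; set a := m1 - n1%:R + (m2 - n2%:R).
have -> : m + a = 2 * m - n%:R by rewrite nE /m /a; ring.
rewrite qrising_rev /cg_scal -/m.
rewrite -[qfact h n]/(qf (qpow h) n).
rewrite -[\prod_(_ < _) br _ _]/(\prod_(k < n) qnum h (2 * m - k%:R)).
move: (\prod_(_ < _) _) (qf _ n) (D _ _ _) => P f d.
rewrite big_mkcond /=.
set E := _ - _ - _.
set S := \sum_(_ < _) _; set S' := \sum_(_ < _) _.
suff eS : signpow (J%:R / 2 + n1%:R) * qpow h E * S = signpow (J%:R / 2) * S'.
  transitivity (f * d / P * (signpow (J%:R / 2 + n1%:R) * qpow h E * S)).
    by ring.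
  by rewrite eS; ring.
rewrite /S /S' !mulr_sumr; apply: eq_bigr => z _.
have zn : (z <= n)%N by rewrite -ltnS.
(* The terms omitted in the definition are those where an [fcprod] contains a zero factor. *)
case: ifP => [/andP[z1 z2]|/negbT]; last first.
  rewrite negb_and -!ltnNge => /orP[lt|lt].
    by rewrite (fcprod_gt _ _ lt) mul0r !(mulr0, mul0r).
  by rewrite (fcprod_gt _ _ lt) !(mulr0, mul0r).
rewrite /sing.
have -> : (n1 - z + (n2 - (n - z)))%N = J by lia.
rewrite eqxx.
have eQ : qpow h E * qpow h (z%:R * (2 * m - n%:R + 1)) =
    qpow h (- ((n - z)%:R * (2 * (m1 - n1%:R) + z%:R))) *
    qpow h (m2 ^+ 2 - (m2 - (n2 - (n - z))%:R) ^+ 2 - (n1 - z)%:R).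
  rewrite -!qpowD /E /m /a (natrB _ z2) (natrB _ zn) (natrB _ z1) nE.
  by congr qpow; ring.
have es : signpow (J%:R / 2 + n1%:R) * (-1) ^+ z =
    signpow (J%:R / 2) * (-1) ^+ (n1 - z) :> R[i].
  rewrite signpowD; move: (signpow _) => s.
  by rewrite -{1}(subnK z1) exprD -!mulrA -expr2 sqrr_sign mulr1.
have r1 : m1 + (m1 - n1%:R) = 2 * m1 - n1%:R by ring.
have r2 : m2 + (m2 - n2%:R) = 2 * m2 - n2%:R by ring.
have qfE k : qfact h k = qf (qpow h) k by [].
rewrite r1 r2 !qrising_fcprod // !qfE !invfM.
move: (fcprod _ _ _ _) (fcprod _ _ _ _) => c1 c2.
move: (qf _ _)^-1 (qf _ _)^-1 (qf _ _)^-1 (qf _ _)^-1 => f1 f2 f3 f4.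
move: es eQ; move: (signpow _) (signpow (_ + _)) (_ ^+ z) (_ ^+ (n1 - z)) => s2 s1 s3 s4.
move: (qpow h _) (qpow h E) (qpow h (z%:R * _)) (qpow h (- _)) => Q4 Q1 Q2 Q3 es eQ.
transitivity ((s1 * s3) * (Q1 * Q2) * (c1 * c2 * f1 * f2 * f3 * f4)); first by ring.
by rewrite es eQ; ring.
Qed.

Hypothesis hD : Delta_choice h D.

(** [D] squares to the radicand, whose factors are nonzero: in the denominators 2m + 2 + j = 2(m1 +
    m2) - (2J - 2 - j), and the subtracted number is natural as [j < J]. *)
Lemma cg_scal_neq0 m1 m2 J :
  goodq m1 -> goodq m2 -> goodq (m1 + m2) -> cg_scal m1 m2 J != 0.
Proof.
move=> g1 g2 g12; rewrite /cg_scal mulf_neq0 ?signpow_neq0 //.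
have eJ : m1 + m2 - (m1 + m2 - J%:R) = J%:R by ring.
have [|eD _] := hD (m1 := m1) (m2 := m2) (m := m1 + m2 - J%:R).
  by rewrite eJ isN_nat.
rewrite -sqrf_eq0 eD /Delta_radicand eJ toN_nat.
rewrite mulf_neq0 //; first exact: (qf_neq0 br_nat).
rewrite big_mkord; apply/prodf_neq0 => j _.
have -> : 2 * (m1 + m2 - J%:R) + 2 + j%:R = 2 * (m1 + m2) - (2 * J - 2 - j)%:R.
  have jJ : (j < J)%N := ltn_ord j.
  by rewrite !natrB ?natrM; [ring | lia | lia].
apply: mulf_neq0; last by rewrite invr_eq0; apply: g12.
by apply: mulf_neq0; [apply: g1 | apply: g2].
Qed.

(** * The q6j-symbols as recoupling coefficients *)

Section SixJ.
Variables m1 m2 m3 : R[i].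
Hypotheses (g1 : goodq m1) (g2 : goodq m2) (g3 : goodq m3).
Hypotheses (g12 : goodq (m1 + m2)) (g23 : goodq (m2 + m3)).
Hypothesis g123 : goodq (m1 + m2 + m3).
Variables J J' : nat.

Let m12 := m1 + m2 - J%:R.
Let m := m12 + m3 - J'%:R.

Lemma e12_cg n1 n2 n3 a : a = m1 + m2 + m3 - (n1 + n2 + n3)%:R ->
  e12 h D m1 m2 m3 m12 m a (m1 - n1%:R) (m2 - n2%:R) (m3 - n3%:R) =
  cg12 (qpow h) cg_scal m1 m2 m3 J J' n1 n2 n3.
Proof.
move=> {a}->; rewrite /e12 /cg12 q3j_cg //.
have [lt|le] := ltnP (n1 + n2) J; first by rewrite cg_lt // !mulr0.
have -> : m1 - n1%:R + (m2 - n2%:R) = m12 - (n1 + n2 - J)%:R.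
  by rewrite natrB // natrD /m12; ring.
by rewrite q3j_cg // natrB // !natrD /m12; ring.
Qed.

Lemma e23_cg j n1 n2 n3 a : (j <= J + J')%N ->
  a = m1 + m2 + m3 - (n1 + n2 + n3)%:R ->
  e23 h D m1 m2 m3 (m2 + m3 - j%:R) m a (m1 - n1%:R) (m2 - n2%:R) (m3 - n3%:R) =
  cg23 (qpow h) cg_scal m1 m2 m3 j (J + J' - j) n1 n2 n3.
Proof.
move=> jN {a}->; rewrite /e23 /cg23 [X in _ * X]q3j_cg //.
have [lt|le] := ltnP (n2 + n3) j; first by rewrite cg_lt // !mulr0.
have -> : m2 - n2%:R + (m3 - n3%:R) = m2 + m3 - j%:R - (n2 + n3 - j)%:R.
  by rewrite natrB // natrD; ring.
have -> : m = m1 + (m2 + m3 - j%:R) - (J + J' - j)%:R.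
  by rewrite natrB // natrD /m /m12; ring.
by rewrite q3j_cg // natrB // !natrD; ring.
Qed.

Lemma e12_supp a a1 a2 a3 : e12 h D m1 m2 m3 m12 m a a1 a2 a3 != 0 ->
  [/\ isN (m1 - a1), isN (m2 - a2), isN (m3 - a3) & a = a1 + a2 + a3].
Proof.
rewrite /e12 mulf_eq0 negb_or /q3j => /andP[].
case: ifP => [/and5P[_ _ i3 _ /eqP ->] _|_]; last by move=> /negP[].
by case: ifP => [/and5P[_ i1 i2 _ _]|_ /negP[]//].
Qed.

Lemma e23_supp m23 a a1 a2 a3 : e23 h D m1 m2 m3 m23 m a a1 a2 a3 != 0 ->
  [/\ isN (m1 - a1), isN (m2 - a2), isN (m3 - a3) & a = a1 + a2 + a3].
Proof.
rewrite /e23 mulf_eq0 negb_or /q3j => /andP[].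
case: ifP => [/and5P[_ i1 _ _ /eqP ->] _|_]; last by move=> /negP[].
by case: ifP => [/and5P[_ i2 i3 _ _] _|_ /negP[]//]; rewrite addrA.
Qed.

Lemma q6j_familiesP c :
  q6j_families h D m1 m2 m12 m3 m c <->
  is_sixj (qpow h) cg_scal m1 m2 m3 J J' (fun j => c (m2 + m3 - j%:R)).
Proof.
have eN : m1 + m2 + m3 - m = (J + J')%:R by rewrite natrD /m /m12; ring.
rewrite /q6j_families /= eN toN_nat; split=> hc.
  (* Below degree [J + J'] the weight lies outside m - Z_{>= 0} and [hc] gives nothing; both sides
     vanish by degree. *)
  move=> n1 n2 n3; have [lt|le] := ltnP (n1 + n2 + n3) (J + J').
    rewrite cg12_lt // big1 // => j _; rewrite cg23_lt ?mulr0 // subnKC //.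
    by rewrite -ltnS.
  rewrite -(e12_cg (erefl (m1 + m2 + m3 - (n1 + n2 + n3)%:R))) hc.
    by apply: eq_bigr => j _; rewrite e23_cg // -ltnS.
  have -> : m - (m1 + m2 + m3 - (n1 + n2 + n3)%:R) =
            (n1 + n2 + n3)%:R - (J + J')%:R by rewrite -eN; ring.
  by rewrite isN_natB.
move=> a _ a1 a2 a3.
have [/and4P[/isNP[n1 e1] /isNP[n2 e2] /isNP[n3 e3] /eqP ea]|ns] :=
  boolP [&& isN (m1 - a1), isN (m2 - a2), isN (m3 - a3) & a == a1 + a2 + a3].
  have -> : a1 = m1 - n1%:R by rewrite -e1; ring.
  have -> : a2 = m2 - n2%:R by rewrite -e2; ring.
  have -> : a3 = m3 - n3%:R by rewrite -e3; ring.
  have {}ea : a = m1 + m2 + m3 - (n1 + n2 + n3)%:R.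
    by rewrite ea !natrD -e1 -e2 -e3; ring.
  by rewrite e12_cg // hc; apply: eq_bigr => j _; rewrite e23_cg // -ltnS.
rewrite [LHS](_ : _ = 0); last first.
  apply/eqP; apply: contraNT ns => /e12_supp[-> -> -> ->].
  by rewrite eqxx.
apply/esym/big1 => j _; rewrite [X in _ * X](_ : _ = 0) ?mulr0 //.
apply/eqP; apply: contraNT ns => /e23_supp[-> -> -> ->].
by rewrite eqxx.
Qed.

(** Existence excludes the default of [xget]; uniqueness makes its choice, made separately for each
    weight, immaterial. *)
Lemma q6j_is_sixj :
  is_sixj (qpow h) cg_scal m1 m2 m3 J J'
    (fun j => q6j h D m1 m2 m12 m3 m (m2 + m3 - j%:R)).
Proof.
have [c hc] := is_sixj_exists (@qpowD h) (qpow0 h) br_nat cg_scal_neq0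
  g1 g2 g3 g12 g23 g123 J J'.
have uniq := is_sixj_unique (@qpowD h) (qpow0 h) br_nat cg_scal_neq0
  g1 g2 g3 g23 g123.
suff eq_c j : (j <= J + J')%N -> q6j h D m1 m2 m12 m3 m (m2 + m3 - j%:R) = c j.
  move=> n1 n2 n3; rewrite hc; apply: eq_bigr => j _.
  by rewrite eq_c // -ltnS.
move=> jN; rewrite /q6j; case: xgetP => [x -> [c' /q6j_familiesP hc' <-]|none].
  exact: (uniq _ _ _ _ hc' hc).
pose c' x := c (toN (m2 + m3 - x)).
have c'E i : c' (m2 + m3 - i%:R) = c i.
  by rewrite /c' (_ : _ - _ = i%:R) ?toN_nat //; ring.
case: (none (c' (m2 + m3 - j%:R))); exists c' => //.
by apply/q6j_familiesP => n1 n2 n3; rewrite hc; apply: eq_bigr => i _; rewrite c'E.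
Qed.

End SixJ.

End Symbols.
End Symbols_over_C.

Lemma generic_br_nat (R : realType) (h : R[i]) (l : seq R[i]) :
  q_generic h l -> forall n, qnum h n.+1%:R != 0.
Proof.
move=> hq n; have := hq n.+1%:Z (fun=> 0).
rewrite /= big1 => [|i _]; last by rewrite mulr0 mul0r.
by rewrite addr0; apply; rewrite pnatr_eq0.
Qed.

(** The booleans encode a nonempty subset with sum s; 2s - k lies in the lattice of [q_generic] and
    is nonzero because s is not in (1/2) Z_{>= 0}. *)
Lemma generic_good (R : realType) (h l1 l2 l3 l4 : R[i]) :
  let l := [:: l1; l2; l3; l4] in
  q_generic h l ->
  (forall I : {set 'I_4}, I != finset.set0 -> ~~ is_halfN (\sum_(i in I) l`_i)) ->
  forall b1 b2 b3 b4 : bool, [|| b1, b2, b3 | b4] ->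
  good (qpow h) (l1 *+ b1 + l2 *+ b2 + l3 *+ b3 + l4 *+ b4).
Proof.
move=> l hq hl b1 b2 b3 b4 b_neq0 k.
pose b := [:: b1; b2; b3; b4].
pose I := [set i : 'I_4 | nth false b i].
have sumI : \sum_(i in I) l`_i = l1 *+ b1 + l2 *+ b2 + l3 *+ b3 + l4 *+ b4.
  rewrite (eq_bigl (fun i : 'I_4 => nth false b i)) => [|i]; last by rewrite inE.
  rewrite big_mkcond !big_ord_recl big_ord0 /= addr0 !addrA.
  by case: b1 b2 b3 b4 {b_neq0 b I} => [] [] [] [].
have I_neq0 : I != finset.set0.
  apply/set0Pn; move: b_neq0 => /or4P[] bi;
    [exists (inord 0) | exists (inord 1) | exists (inord 2) | exists (inord 3)];
    by rewrite inE inordK.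
have := hq (- k%:Z) (fun i => (i \in I)%:Z).
have -> : (- k%:Z)%:~R + \sum_(i < 4) 2 * (i \in I)%:Z%:~R * l`_i =
    2 * (l1 *+ b1 + l2 *+ b2 + l3 *+ b3 + l4 *+ b4) - k%:R.
  rewrite -sumI mulr_sumr [in RHS]big_mkcond /= addrC rmorphN /=; congr (_ - _).
  by apply: eq_bigr => i _; case: ifP; rewrite ?mulr1 // mulr0 mul0r.
apply; apply: contraNN (hl I I_neq0) => /eqP e; apply/isNP; exists k.
by rewrite sumI; apply/subr0_eq.
Qed.

Theorem theorem6p5 (R : realType) (h : R[i])
    (D : R[i] -> R[i] -> R[i] -> R[i])
    (l1 l2 l3 l4 l12 l34 l123 l234 l1234 : R[i])
    (hq : q_generic h [:: l1; l2; l3; l4])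
    (hD : Delta_choice h D)
    (hl : forall I : {set 'I_4}, I != finset.set0 ->
        ~~ is_halfN (\sum_(i in I) [:: l1; l2; l3; l4]`_i))
    (h12 : isN (l1 + l2 - l12))
    (h34 : isN (l3 + l4 - l34))
    (h12_3 : isN (l12 + l3 - l123))
    (h2_34 : isN (l2 + l34 - l234))
    (h123_4 : isN (l123 + l4 - l1234))
    (h1_234 : isN (l1 + l234 - l1234))
    (h12_34 : isN (l12 + l34 - l1234)) :
  \sum_(j < (minn (toN (l2 + l3 + l4 - l234)) (toN (l1 + l2 + l3 - l123))).+1)
    (let al := l2 + l3 - j%:R in
     q6j h D l1 l2 l12 l3 l123 al *
     q6j h D l1 al l123 l4 l1234 l234 *
     q6j h D l2 l3 al l4 l234 l34) =
  q6j h D l12 l3 l123 l4 l1234 l34 * q6j h D l1 l2 l12 l34 l1234 l234.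
Proof.
have br_nat := generic_br_nat hq.
have gd := generic_good hq hl.
have g1 : good (qpow h) l1 by have := gd true false false false isT; rewrite !addr0.
have g2 : good (qpow h) l2.
  by have := gd false true false false isT; rewrite add0r !addr0.
have g3 : good (qpow h) l3.
  by have := gd false false true false isT; rewrite !add0r !addr0.
have g4 : good (qpow h) l4.
  by have := gd false false false true isT; rewrite !add0r.
have g12 : good (qpow h) (l1 + l2).
  by have := gd true true false false isT; rewrite !addr0.
have g23 : good (qpow h) (l2 + l3).
  by have := gd false true true false isT; rewrite add0r !addr0.
have g34 : good (qpow h) (l3 + l4).
  by have := gd false false true true isT; rewrite !add0r.
have g123 : good (qpow h) (l1 + l2 + l3).
  by have := gd true true true false isT; rewrite !addr0.
have g234 : good (qpow h) (l2 + l3 + l4).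
  by have := gd false true true true isT; rewrite !add0r.
have g1234 : good (qpow h) (l1 + l2 + l3 + l4) by have := gd true true true true isT.
have /isNP[p12 e12] := h12; have /isNP[p e34] := h34; have /isNP[p3 e3] := h12_3.
have /isNP[r er] := h2_34; have /isNP[p4 e4] := h123_4.
have /isNP[u eu] := h1_234; have /isNP[v ev] := h12_34.
clear h12 h34 h12_3 h2_34 h123_4 h1_234 h12_34 gd.
have d12 : l12 = l1 + l2 - p12%:R by rewrite -e12; ring.
have d34 : l34 = l3 + l4 - p%:R by rewrite -e34; ring.
have d123 : l123 = l12 + l3 - p3%:R by rewrite -e3; ring.
have d234 : l234 = l2 + l34 - r%:R by rewrite -er; ring.
have d1234 : l1234 = l123 + l4 - p4%:R by rewrite -e4; ring.
(* The total drop to [l1234] is the same along every bracketing. [Nu] and [Nv] give the bounds on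
   [t] and [p] that [pentagon] requires. *)
have Nu : (p12 + p3 + p4 = p + r + u)%N.
  by apply/eqP; rewrite -(eqr_nat R[i]) !natrD -eu d1234 d234 d123 d34 d12; apply/eqP; ring.
have Nv : (p3 + p4 = p + v)%N.
  by apply/eqP; rewrite -(eqr_nat R[i]) !natrD -ev d1234 d123 d34 d12; apply/eqP; ring.
clear e12 e34 e3 er e4 eu ev.
pose t := (p + r)%N.
have sixj := q6j_is_sixj br_nat hD.
have eP j : (j <= p12 + p3)%N -> l1 + (l2 + l3 - j%:R) - (p12 + p3 - j)%:R = l123.
  by move=> jP; rewrite natrB // natrD d123 d12; ring.
have eM k : (k <= p3 + p4)%N -> l12 + (l3 + l4 - k%:R) - (p3 + p4 - k)%:R = l1234.
  by move=> kM; rewrite natrB // natrD d1234 d123; ring.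
have -> : l2 + l3 + l4 - l234 = t%:R by rewrite d234 d34 natrD; ring.
have -> : l1 + l2 + l3 - l123 = (p12 + p3)%:R by rewrite d123 d12 natrD; ring.
rewrite !toN_nat /=.
(* The symbols as functions of depths: [b] and [d] reach [l234] at [i = t - j], while [g] and [f]
   reach [l34] and [l234] at [k = p], [s = r]. *)
pose a j := q6j h D l1 l2 l12 l3 l123 (l2 + l3 - j%:R).
pose b j i := q6j h D l1 (l2 + l3 - j%:R) l123 l4 l1234 (l2 + l3 - j%:R + l4 - i%:R).
pose d j i k := q6j h D l2 l3 (l2 + l3 - j%:R) l4 (l2 + l3 - j%:R + l4 - i%:R)
                       (l3 + l4 - k%:R).
pose g k := q6j h D l12 l3 l123 l4 l1234 (l3 + l4 - k%:R).
pose f k s := q6j h D l1 l2 l12 (l3 + l4 - k%:R) l1234 (l2 + (l3 + l4 - k%:R) - s%:R).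
have PG := @pentagon R[i] (qpow h) (@qpowD _ h) (qpow0 h) br_nat (cg_scal D)
  (cg_scal_neq0 br_nat hD) l1 l2 l3 l4.
have ha : is_sixj (qpow h) (cg_scal D) l1 l2 l3 p12 p3 a.
  by have := sixj l1 l2 l3 g1 g2 g3 g12 g23 g123 p12 p3; rewrite -d12 -d123.
have gB x y n : good (qpow h) x -> y = x - n%:R -> good (qpow h) y.
  by move=> gx ->; apply: goodB.
have hb j : (j <= p12 + p3)%N ->
    is_sixj (qpow h) (cg_scal D) l1 (l2 + l3 - j%:R) l4 (p12 + p3 - j) p4 (b j).
  move=> jP; have ga := goodB j g23.
  have g1a : good (qpow h) (l1 + (l2 + l3 - j%:R)) by apply: (gB _ _ j g123); ring.
  have ga4 : good (qpow h) (l2 + l3 - j%:R + l4).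
    by apply: (gB _ _ j g234); ring.
  have g1a4 : good (qpow h) (l1 + (l2 + l3 - j%:R) + l4).
    by apply: (gB _ _ j g1234); ring.
  by have := sixj _ _ _ g1 ga g4 g1a ga4 g1a4 (p12 + p3 - j)%N p4; rewrite eP // -d1234.
have hd j i : is_sixj (qpow h) (cg_scal D) l2 l3 l4 j i (d j i).
  exact: (sixj l2 l3 l4 g2 g3 g4 g23 g34 g234 j i).
have hg : is_sixj (qpow h) (cg_scal D) (l1 + l2 - p12%:R) l3 l4 p3 p4 g.
  have gm : good (qpow h) l12 by rewrite d12; apply: goodB.
  have gm3 : good (qpow h) (l12 + l3).
    by apply: (gB _ _ p12 g123); rewrite d12; ring.
  have gm34 : good (qpow h) (l12 + l3 + l4).
    by apply: (gB _ _ p12 g1234); rewrite d12; ring.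
  rewrite -d12.
  by have := sixj l12 l3 l4 gm g3 g4 gm3 g34 gm34 p3 p4; rewrite -d123 -d1234.
have hf k : (k <= p3 + p4)%N ->
    is_sixj (qpow h) (cg_scal D) l1 l2 (l3 + l4 - k%:R) p12 (p3 + p4 - k) (f k).
  move=> kM; have gk := goodB k g34.
  have g2k : good (qpow h) (l2 + (l3 + l4 - k%:R)) by apply: (gB _ _ k g234); ring.
  have g12k : good (qpow h) (l1 + l2 + (l3 + l4 - k%:R)).
    by apply: (gB _ _ k g1234); ring.
  by have := sixj _ _ _ g1 g2 gk g12 g2k g12k p12 (p3 + p4 - k)%N; rewrite -d12 eM.
have {PG} := PG g1 g2 g3 g4 g34 g234 g1234 _ _ _ _ _ _ _ _ ha hb hd hg hf p t.
rewrite {1}/t leq_addr => /(_ isT).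
have tN : (t <= p12 + p3 + p4)%N by rewrite /t; lia.
have pM : (p <= p3 + p4)%N by lia.
move=> /(_ tN pM); rewrite {2}/t addKn /g /f -d34 -d234 => <-.
(* The range up to the minimum becomes the range up to [p12 + p3] filtered by [j <= t], as in
   [pentagon]. *)
rewrite (big_ord_widen (p12 + p3).+1 (fun j => q6j h D l1 l2 l12 l3 l123 (l2 + l3 - j%:R) *
     q6j h D l1 (l2 + l3 - j%:R) l123 l4 l1234 l234 *
     q6j h D l2 l3 (l2 + l3 - j%:R) l4 l234 l34)); last by rewrite ltnS geq_minr.
apply: eq_big => [j|j]; first by rewrite ltnS leq_min leq_ord andbT.
rewrite ltnS leq_min => /andP[jt _]; rewrite /a /b /d -d34.
have -> : l2 + l3 - j%:R + l4 - (t - j)%:R = l234.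
  by rewrite natrB // d234 d34 /t natrD; ring.
by [].
Qed.
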